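(* Let $G_2$ be the simply connected seven-dimensional Lie group whose Lie algebra $L_2$ is given, in terms of a basis $e^1,\dots,e^7$ of left invariant 1-forms, by $$\begin{aligned} &de^1=0,\quad de^2=-e^{12}+e^{34},\quad de^3=-\tfrac12e^{13},\quad de^4=-\tfrac12e^{14},\\ &de^5=2e^{12}+2e^{34}+e^{37}-e^{46}+\tfrac14e^{67},\quad de^6=2e^{13}-2e^{24}-\tfrac12e^{27}+e^{45}-\tfrac14e^{57},\\ &de^7=2e^{14}+2e^{23}+\tfrac12e^{26}-e^{35}+\tfrac14e^{56}. \end{aligned}$$ Let $e_1,\dots,e_7$ be the dual left invariant frame and equip $G_2$ with the left invariant quaternionic contact structure $(\eta,\mathbb Q)$ given by $\eta_1=e^5$, $\eta_2=e^6$, $\eta_3=e^7$, $H=\mathrm{span}\{e_1,\dots,e_4\}$ with $e_1,\dots,e_4$ orthonormal, $\omega_1=e^{12}+e^{34}$, $\omega_2=e^{13}+e^{42}$, $\omega_3=e^{14}+e^{23}$, with Reeb vector fields $\xi_1=e_5$, $\xi_2=e_6$, $\xi_3=e_7$. Then: (a) the torsion endomorphism of the Biquard connection is zero and the normalized qc scalar curvature is the negative constant $S=-\frac14$; (b) the qc conformal curvature is not zero, $W^{qc}\neq0$, and therefore $(G_2,\eta,\mathbb Q)$ is not locally qc conformally flat.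
   Context: Notation: $e^{ij}=e^i\wedge e^j$, and $d\alpha(A,B)=A\alpha(B)-B\alpha(A)-\alpha([A,B])$, $(\alpha\wedge\beta)(A,B)=\alpha(A)\beta(B)-\alpha(B)\beta(A)$ for 1-forms. Quaternionic contact (qc) structure in dimension 7: a codimension three distribution $H$ on a 7-manifold $M$ with a Riemannian metric $g$ on $H$ and a rank-three bundle $\mathbb Q\subset \mathrm{End}(H)$ locally generated by almost complex structures $I_1,I_2,I_3$ with $I_1I_2=-I_2I_1=I_3$, $I_1I_2I_3=-\mathrm{id}_H$, $g(I_s\cdot,I_s\cdot)=g$, such that $H$ is locally the kernel of a 1-form $\eta=(\eta_1,\eta_2,\eta_3)$ with values in $\mathbb R^3$ with $2g(I_sX,Y)=d\eta_s(X,Y)$ for $X,Y\in H$, $s=1,2,3$, and such that there exist (Reeb) vector fields $\xi_1,\xi_2,\xi_3$ with $\eta_s(\xi_k)=\delta_{sk}$, $(\xi_s\lrcorner d\eta_s)|_H=0$, $(\xi_s\lrcorner d\eta_k)|_H=-(\xi_k\lrcorner d\eta_s)|_H$. Put $V=\mathrm{span}\{\xi_1,\xi_2,\xi_3\}$; $g$ is extended to $TM=H\oplus V$ by $V\perp H$, $g(\xi_s,\xi_k)=\delta_{sk}$. The fundamental 2-forms are $\omega_s(X,Y)=g(I_sX,Y)$ on $H$, with $\xi\lrcorner\omega_s=0$ for $\xi\in V$. Biquard connection: the unique linear connection $\nabla$ on $M$, with torsion $T$, such that (i) $\nabla$ preserves $H\oplus V$ and the metric $g$; (ii) $T(X,Y)=-[X,Y]_{|V}$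 for $X,Y\in H$; (iii) $\nabla$ preserves the $Sp(1)Sp(1)$ structure on $H$ ($\nabla g=0$ and $\nabla\sigma\in\Gamma(\mathbb Q)$ for $\sigma\in\Gamma(\mathbb Q)$); (iv) for $\xi\in V$ the endomorphism $T_\xi:=T(\xi,\cdot)$ of $H$ lies in $(sp(1)\oplus sp(1))^\perp\subset gl(4)$, for the inner product $\langle A,B\rangle=\sum_i g(Ae_i,Be_i)$; (v) $\nabla\varphi=0$ where $\varphi$ identifies $V$ with $\mathbb Q\cong sp(1)$ by $\xi_s\mapsto I_s$. The endomorphisms $T_\xi:H\to H$, $\xi\in V$, form the torsion endomorphism of the Biquard connection. Curvature: $R(A,B)=[\nabla_A,\nabla_B]-\nabla_{[A,B]}$, $R(A,B,C,D)=g(R(A,B)C,D)$. The normalized qc scalar curvature $S$ is defined by $24S=\sum_{a,b=1}^4R(e_b,e_a,e_a,e_b)$ for an orthonormal basis $e_1,\dots,e_4$ of $H$. Put $T^0(X,Y)=g\big(\sum_{s}T_{\xi_s}I_sX,Y\big)$ for $X,Y\in H$. For (0,2) tensors $A,B$ on $H$ let $(A\star B)(X,Y,Z,W)=A(X,Z)B(Y,W)+A(Y,W)B(X,Z)-A(Y,Z)B(X,W)-A(X,W)B(Y,Z)$. In dimension seven the qc conformal curvature is the tensor on $H$ $$W^{qc}(X,Y,Z,W)=\tfrac14\Big[R(X,Y,Z,W)+\sum_{s}R(I_sX,I_sY,Z,W)\Big]-\tfrac12\sum_{s}\omega_s(Z,W)\big[T^0(X,I_sY)-T^0(I_sX,Y)\big]+\tfrac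 S4\Big[g\star g+\sum_{s}\omega_s\star\omega_s\Big](X,Y,Z,W).$$ Locally qc conformally flat means locally qc conformal to the 7-dimensional quaternionic Heisenberg group, i.e. around each point there is a local diffeomorphism to that group pulling its contact form back to $\mu\Psi\eta$ with $\mu>0$ a smooth function and $\Psi$ a smooth $SO(3)$-valued function. The quaternionic Heisenberg group is the simply connected Lie group with left invariant coframe $e^1,\dots,e^4,\eta_1,\eta_2,\eta_3$ satisfying $de^a=0$, $d\eta_1=2(e^{12}+e^{34})$, $d\eta_2=2(e^{13}+e^{42})$, $d\eta_3=2(e^{14}+e^{23})$, with its contact form $(\eta_1,\eta_2,\eta_3)$. *)

(* Defs.v *)
From HB Require Import structures.
From mathcomp Require Import all_boot all_order all_algebra.
From mathcomp Require Import all_classical all_reals all_analysis.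

Set Implicit Arguments.
Unset Strict Implicit.
Unset Printing Implicit Defensive.

Import Order.TTheory GRing.Theory Num.Theory.
Import numFieldNormedType.Exports.

Local Open Scope classical_set_scope.
Local Open Scope ring_scope.

(** * Smooth functions on normed spaces *)

Definition iter_derive (R : realType) (V : normedModType R)
    (s : seq V) (f : V -> R^o) : V -> R^o :=
  foldr (fun v h => fun x => 'D_v h x) f s.

(* On a finite-dimensional V this is C^oo on U: all iterated directional
   derivatives exist and are continuous. *)
Definition smooth_on (R : realType) (V : normedModType R)
    (U : set V) (f : V -> R^o) : Prop :=
  forall (s : seq V) (x : V), U x ->
    {for x, continuous (iter_derive s f)} /\
    (forall v : V, derivable (iter_derive s f) x v).

Definition smooth_near (R : realType) (V : normedModType R)
    (x : V) (f : V -> R^o) : Prop :=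
  exists U : set V, [/\ open U, U x & smooth_on U f].

(** * Smooth manifolds *)

(* The maps are total; only their values on [chart_dom] and on
   [chart_map @` chart_dom] are meaningful. *)
Record chart (R : realType) (n : nat) (T : topologicalType) := Chart {
  chart_dom : set T;
  chart_map : T -> 'rV[R]_n;
  chart_inv : 'rV[R]_n -> T }.

Definition is_chart (R : realType) (n : nat) (T : topologicalType)
    (c : chart R n T) : Prop :=
  [/\ open (chart_dom c), open (chart_map c @` chart_dom c),
      forall x, chart_dom c x -> chart_inv c (chart_map c x) = x,
      forall x, chart_dom c x -> {for x, continuous (chart_map c)}
    & forall x, chart_dom c x ->
        {for chart_map c x, continuous (chart_inv c)}].

Definition chart_compat (R : realType) (n : nat) (T : topologicalType)
    (c d : chart R n T) : Prop :=
  forall x, chart_dom c x -> chart_dom d x -> forall j : 'I_n,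
    smooth_near (chart_map c x)
      (fun y => chart_map d (chart_inv c y) ord0 j).

Record manifold (R : realType) (n : nat) := Manifold {
  points :> topologicalType;
  atlas : set (chart R n points);
  manifold_hausdorff : hausdorff_space points;
  manifold_second_countable : @second_countable points;
  atlas_chart : forall c, atlas c -> is_chart c;
  atlas_cover : forall x, exists c, atlas c /\ chart_dom c x;
  atlas_compat : forall c d, atlas c -> atlas d -> chart_compat c d }.

(* f is smooth on a neighbourhood of p. *)
Definition smooth_at (R : realType) (n : nat) (M : manifold R n)
    (p : M) (f : M -> R) : Prop :=
  \forall q \near p, forall c, atlas c -> chart_dom c q ->
    smooth_near (chart_map c q) (fun y => f (chart_inv c y)).

(* Smoothness at (p, q) on the product manifold, in product charts. *)
Definition smooth_at2 (R : realType) (m n : nat)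
    (M : manifold R m) (N : manifold R n) (p : M) (q : N)
    (f : M -> N -> R) : Prop :=
  forall c d, atlas c -> chart_dom c p -> atlas d -> chart_dom d q ->
    smooth_near (chart_map c p, chart_map d q)
      (fun y : 'rV[R]_m * 'rV[R]_n =>
         f (chart_inv c y.1) (chart_inv d y.2)).

Definition smooth_map_at (R : realType) (m n : nat)
    (M : manifold R m) (N : manifold R n) (F : M -> N) (p : M) : Prop :=
  {for p, continuous F} /\
  (forall h : N -> R, smooth_at (F p) h -> smooth_at p (h \o F)).

Definition simply_connected (R : realType) (T : topologicalType) : Prop :=
  (forall x y : T, exists c : R -> T,
     [/\ {within `[0, 1], continuous c}, c 0 = x & c 1 = y]) /\
  (forall c : R -> T, {within `[0, 1], continuous c} -> c 0 = c 1 ->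
     exists H : R * R -> T,
       [/\ {within `[0, 1] `*` `[0, 1], continuous H},
           forall t, 0 <= t <= 1 -> H (0, t) = c t /\ H (1, t) = c 0
         & forall s, 0 <= s <= 1 -> H (s, 0) = c 0 /\ H (s, 1) = c 0]).

(** * Lie groups *)

Record lieGroup (R : realType) (n : nat) := LieGroup {
  lie_manifold :> manifold R n;
  lie_mul : lie_manifold -> lie_manifold -> lie_manifold;
  lie_one : lie_manifold;
  lie_inv : lie_manifold -> lie_manifold;
  lie_mulA : associative lie_mul;
  lie_mul1 : left_id lie_one lie_mul;
  lie_mulV : left_inverse lie_one lie_inv lie_mul;
  lie_mul_continuous :
    continuous (fun x : lie_manifold * lie_manifold => lie_mul x.1 x.2);
  lie_mul_smooth : forall (x y : lie_manifold) (f : lie_manifold -> R),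
    smooth_at (lie_mul x y) f ->
    smooth_at2 x y (fun x' y' => f (lie_mul x' y'));
  lie_inv_smooth : forall x, smooth_map_at lie_inv x }.

(** * Tangent vectors, vector fields and forms *)

Section Calculus.
Context (R : realType) (n : nat) (M : manifold R n).

Definition smooth_fun (f : M -> R) : Prop := forall p, smooth_at p f.

(* Tangent vectors at p are derivations of the germs at p of smooth functions.
   They are extended by 0 to functions that are not smooth at p, so that equal
   derivations are equal terms. *)
Definition tvec : Type := (M -> R) -> R^o.

Record tangent (p : M) (v : tvec) : Prop := Tangent {
  tangent_linear : forall (a : R) (f h : M -> R),
    smooth_at p f -> smooth_at p h ->
    v (fun q => a * f q + h q) = a * v f + v h;
  tangent_leibniz : forall f h : M -> R, smooth_at p f -> smooth_at p h ->
    v (fun q => f q * h q) = v f * h p + f p * v h;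
  tangent_germ : forall f h : M -> R, smooth_at p f ->
    (\forall q \near p, f q = h q) -> v f = v h;
  tangent_junk : forall f : M -> R, ~ smooth_at p f -> v f = 0 }.

Definition vfield : Type := M -> tvec.

Definition vf_app (X : vfield) (f : M -> R) : M -> R := fun p => X p f.

Definition smooth_vf (X : vfield) : Prop :=
  (forall p, tangent p (X p)) /\
  (forall p f, smooth_at p f -> smooth_at p (vf_app X f)).

Definition vf_add (X Y : vfield) : vfield := fun p => X p + Y p.

Definition vf_scale (f : M -> R) (X : vfield) : vfield :=
  fun p => f p *: X p.

Definition bracket (X Y : vfield) : vfield := fun p f =>
  if `[< smooth_at p f >] then X p (vf_app Y f) - Y p (vf_app X f) else 0.

Definition oneform : Type := M -> tvec -> R.
Definition twoform : Type := M -> tvec -> tvec -> R^o.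

Definition smooth_form (alpha : oneform) : Prop :=
  (forall p (a : R) u v, tangent p u -> tangent p v ->
     alpha p (a *: u + v) = a * alpha p u + alpha p v) /\
  (forall X, smooth_vf X -> smooth_fun (fun p => alpha p (X p))).

Definition dform (alpha : oneform) (A B : vfield) : M -> R := fun p =>
  A p (fun q => alpha q (B q)) - B p (fun q => alpha q (A q))
  - alpha p (bracket A B p).

Definition wedge (alpha beta : oneform) : twoform := fun p u v =>
  alpha p u * beta p v - beta p u * alpha p v.

Definition has_differential (alpha : oneform) (omega : twoform) : Prop :=
  forall A B, smooth_vf A -> smooth_vf B ->
    forall p, dform alpha A B p = omega p (A p) (B p).

Definition is_coframe (th : 'I_n -> oneform) (e : 'I_n -> vfield) : Prop :=
  [/\ forall i, smooth_form (th i),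
      forall i, smooth_vf (e i),
      forall i j p, th i p (e j p) = (i == j)%:R
    & forall p v, tangent p v -> v = \sum_(i < n) th i p v *: e i p].

End Calculus.

Definition differential (R : realType) (m n : nat)
    (M : manifold R m) (N : manifold R n) (F : M -> N) (p : M)
    (v : tvec M) : tvec N :=
  fun h => if `[< smooth_at (F p) h >] then v (h \o F) else 0.

Definition left_invariant (R : realType) (n : nat) (G : lieGroup R n)
    (alpha : oneform G) : Prop :=
  forall (a p : G) (v : tvec G), tangent p v ->
    alpha (lie_mul a p) (differential (lie_mul a) p v) = alpha p v.

(** * Quaternionic contact structures with a global contact form *)

(* [qc_g] is the metric extended to TM; H is the kernel of [qc_eta]. *)
Record qc_data (R : realType) (n : nat) (M : manifold R n) := QcData {
  qc_eta : 'I_3 -> oneform M;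
  qc_g : M -> tvec M -> tvec M -> R;
  qc_I : 'I_3 -> M -> tvec M -> tvec M;
  qc_xi : 'I_3 -> vfield M }.

Notation i3 k := (@Ordinal 3 k.-1 isT) (only parsing).

Section QuaternionicContact.
Context (R : realType) (n : nat) (M : manifold R n) (q : qc_data M).

Local Notation eta := (qc_eta q).
Local Notation g := (qc_g q).
Local Notation I := (qc_I q).
Local Notation xi := (qc_xi q).

Definition hor (p : M) (v : tvec M) : Prop :=
  tangent p v /\ forall s, eta s p v = 0.

Definition ver (p : M) (v : tvec M) : Prop :=
  exists c : 'I_3 -> R, v = \sum_(s < 3) c s *: xi s p.

Definition hor_field (X : vfield M) : Prop :=
  smooth_vf X /\ forall p, hor p (X p).

Definition ver_field (X : vfield M) : Prop :=
  smooth_vf X /\ forall p, ver p (X p).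

Definition I_field (s : 'I_3) (X : vfield M) : vfield M :=
  fun p => I s p (X p).

Definition endo_hor (p : M) (C : tvec M -> tvec M) : Prop :=
  (forall v, hor p v -> hor p (C v)) /\
  (forall (a : R) u v, hor p u -> hor p v -> C (a *: u + v) = a *: C u + C v).

Record is_qc : Prop := IsQc {
  qc_eta_smooth : forall s, smooth_form (eta s);
  qc_xi_smooth : forall s, smooth_vf (xi s);
  qc_g_sym : forall p u v, tangent p u -> tangent p v -> g p u v = g p v u;
  qc_g_linear : forall p (a : R) u v w,
    tangent p u -> tangent p v -> tangent p w ->
    g p (a *: u + v) w = a * g p u w + g p v w;
  qc_g_pos : forall p v, tangent p v -> v <> 0 -> 0 < g p v v;
  qc_g_smooth : forall X Y, smooth_vf X -> smooth_vf Y ->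
    smooth_fun (fun p => g p (X p) (Y p));
  qc_g_HV : forall p v s, hor p v -> g p v (xi s p) = 0;
  qc_g_V : forall p s k, g p (xi s p) (xi k p) = (s == k)%:R;
  qc_I_endo : forall s p, endo_hor p (I s p);
  qc_I_smooth : forall s X, hor_field X -> smooth_vf (I_field s X);
  qc_I_square : forall s p v, hor p v -> I s p (I s p v) = - v;
  qc_I12 : forall p v, hor p v -> I (i3 1) p (I (i3 2) p v) = I (i3 3) p v;
  qc_I21 : forall p v, hor p v -> I (i3 2) p (I (i3 1) p v) = - I (i3 3) p v;
  qc_I123 : forall p v, hor p v ->
    I (i3 1) p (I (i3 2) p (I (i3 3) p v)) = - v;
  qc_I_isometry : forall s p u v, hor p u -> hor p v ->
    g p (I s p u) (I s p v) = g p u v;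
  qc_contact : forall s X Y, hor_field X -> hor_field Y -> forall p,
    2 * g p (I s p (X p)) (Y p) = dform (eta s) X Y p;
  qc_reeb_dual : forall s k p, eta s p (xi k p) = (s == k)%:R;
  qc_reeb1 : forall s X, hor_field X -> forall p,
    dform (eta s) (xi s) X p = 0;
  qc_reeb2 : forall s k X, hor_field X -> forall p,
    dform (eta k) (xi s) X p = - dform (eta s) (xi k) X p }.

Definition qc_omega (s : 'I_3) (p : M) (u v : tvec M) : R := g p (I s p u) v.

(** ** The Biquard connection *)

Record is_connection (nabla : vfield M -> vfield M -> vfield M) : Prop :=
  IsConnection {
  conn_smooth : forall A B, smooth_vf A -> smooth_vf B ->
    smooth_vf (nabla A B);
  conn_left : forall f A A' B, smooth_fun f ->
    smooth_vf A -> smooth_vf A' -> smooth_vf B ->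
    nabla (vf_add (vf_scale f A) A') B =
    vf_add (vf_scale f (nabla A B)) (nabla A' B);
  conn_add : forall A B B', smooth_vf A -> smooth_vf B -> smooth_vf B' ->
    nabla A (vf_add B B') = vf_add (nabla A B) (nabla A B');
  conn_leibniz : forall f A B, smooth_fun f -> smooth_vf A -> smooth_vf B ->
    nabla A (vf_scale f B) =
    vf_add (vf_scale (vf_app A f) B) (vf_scale f (nabla A B)) }.

Definition torsion (nabla : vfield M -> vfield M -> vfield M)
    (A B : vfield M) : vfield M :=
  fun p => nabla A B p - nabla B A p - bracket A B p.

(* The section of Q with coefficients a in the basis I_1, I_2, I_3. *)
Definition Q_section (a : 'I_3 -> M -> R) (p : M) (v : tvec M) : tvec M :=
  \sum_(s < 3) a s p *: I s p v.

(* The identification V -> Q sending xi_s to I_s. *)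
Definition phi (p : M) (v : tvec M) : tvec M -> tvec M := fun w =>
  \sum_(s < 3) eta s p v *: I s p w.

(* The fields E_a need to be orthonormal at the point p only. *)
Definition orthonormal_at (p : M) (E : 'I_4 -> vfield M) : Prop :=
  (forall a, hor_field (E a)) /\
  (forall a b, g p (E a p) (E b p) = (a == b)%:R).

(* sp(1) + sp(1) at p: the sum of Q_p and of the skew endomorphisms of H_p
   that commute with Q_p. *)
Definition sp1sp1 (p : M) (B : tvec M -> tvec M) : Prop :=
  exists (c : 'I_3 -> R) (C : tvec M -> tvec M),
  [/\ endo_hor p C,
      forall u v, hor p u -> hor p v -> g p (C u) v = - g p u (C v),
      forall s v, hor p v -> C (I s p v) = I s p (C v)
    & forall v, hor p v -> B v = \sum_(s < 3) c s *: I s p v + C v].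

Record is_biquard (nabla : vfield M -> vfield M -> vfield M) : Prop :=
  IsBiquard {
  bq_conn : is_connection nabla;
  bq_hor : forall A X, smooth_vf A -> hor_field X -> hor_field (nabla A X);
  bq_ver : forall A X, smooth_vf A -> ver_field X -> ver_field (nabla A X);
  bq_metric : forall A B C, smooth_vf A -> smooth_vf B -> smooth_vf C ->
    forall p, A p (fun x => g x (B x) (C x)) =
              g p (nabla A B p) (C p) + g p (B p) (nabla A C p);
  bq_torsion_hor : forall X Y, hor_field X -> hor_field Y -> forall p,
    torsion nabla X Y p =
    - \sum_(s < 3) eta s p (bracket X Y p) *: xi s p;
  bq_Q : forall A (a : 'I_3 -> M -> R), smooth_vf A ->
    (forall s, smooth_fun (a s)) ->
    exists b : 'I_3 -> M -> R, (forall s, smooth_fun (b s)) /\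
      (forall X, hor_field X -> forall p,
         nabla A (fun x => Q_section a x (X x)) p
         - Q_section a p (nabla A X p) = Q_section b p (X p));
  bq_torsion_ver : forall U X, ver_field U -> hor_field X ->
    hor_field (torsion nabla U X);
  bq_torsion_perp : forall U p E B, ver_field U -> orthonormal_at p E ->
    sp1sp1 p B ->
    \sum_(a < 4) g p (torsion nabla U (E a) p) (B (E a p)) = 0;
  bq_phi : forall A U X, smooth_vf A -> ver_field U -> hor_field X ->
    forall p,
    nabla A (fun x => phi x (U x) (X x)) p - phi p (U p) (nabla A X p) =
    phi p (nabla A U p) (X p) }.

(* Uniqueness is up to the irrelevant values on non-smooth fields. *)
Definition is_the_biquard_connection
    (nabla : vfield M -> vfield M -> vfield M) : Prop :=
  is_biquard nabla /\
  (forall nabla', is_biquard nabla' ->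
     forall A B, smooth_vf A -> smooth_vf B -> nabla' A B = nabla A B).

(** ** Curvature *)

Definition curvature (nabla : vfield M -> vfield M -> vfield M)
    (A B C : vfield M) : vfield M := fun p =>
  nabla A (nabla B C) p - nabla B (nabla A C) p - nabla (bracket A B) C p.

Definition Rm (nabla : vfield M -> vfield M -> vfield M)
    (A B C D : vfield M) (p : M) : R :=
  g p (curvature nabla A B C p) (D p).

Definition is_qc_scalar (nabla : vfield M -> vfield M -> vfield M)
    (S : M -> R) : Prop :=
  forall p E, orthonormal_at p E ->
    24 * S p =
    \sum_(a < 4) \sum_(b < 4) Rm nabla (E b) (E a) (E a) (E b) p.

Definition T0 (nabla : vfield M -> vfield M -> vfield M)
    (X Y : vfield M) (p : M) : R :=
  g p (\sum_(s < 3) torsion nabla (xi s) (I_field s X) p) (Y p).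

Definition star (A B : tvec M -> tvec M -> R) (x y z w : tvec M) : R :=
  A x z * B y w + A y w * B x z - A y z * B x w - A x w * B y z.

Definition qc_W (nabla : vfield M -> vfield M -> vfield M) (S : M -> R)
    (X Y Z W : vfield M) (p : M) : R :=
  4^-1 * (Rm nabla X Y Z W p
          + \sum_(s < 3) Rm nabla (I_field s X) (I_field s Y) Z W p)
  - 2^-1 * \sum_(s < 3) qc_omega s p (Z p) (W p) *
      (T0 nabla X (I_field s Y) p - T0 nabla (I_field s X) Y p)
  + S p / 4 *
      (star (g p) (g p) (X p) (Y p) (Z p) (W p)
       + \sum_(s < 3)
           star (qc_omega s p) (qc_omega s p) (X p) (Y p) (Z p) (W p)).

End QuaternionicContact.

(** * Local qc conformal equivalence *)

Definition locally_qc_conformal (R : realType) (m n : nat)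
    (M : manifold R m) (N : manifold R n)
    (eta : 'I_3 -> oneform M) (eta' : 'I_3 -> oneform N) : Prop :=
  forall p : M,
  exists (U : set M) (F : M -> N) (F' : N -> M)
         (mu : M -> R) (Psi : M -> 'M[R]_3),
  [/\ [/\ open U, U p & open (F @` U)],
      forall x, U x ->
        [/\ F' (F x) = x, smooth_map_at F x & smooth_map_at F' (F x)],
      forall x, U x -> 0 < mu x /\ smooth_at x mu,
      forall x, U x ->
        [/\ Psi x *m (Psi x)^T = 1%:M, \det (Psi x) = 1
          & forall s t, smooth_at x (fun y => Psi y s t)]
    & forall x, U x -> forall s v, tangent x v ->
        eta' s (F x) (differential F x v) =
        mu x * \sum_(t < 3) Psi x s t * eta t x v].

(** * Left invariant coframes on 7-dimensional groups *)

Notation i7 k := (@Ordinal 7 k.-1 isT) (only parsing).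

Section Coframe7.
Context (R : realType) (G : lieGroup R 7).
Variables (th : 'I_7 -> oneform G) (e : 'I_7 -> vfield G).

Definition eta_of (s : 'I_3) : oneform G := th (rshift 4 s : 'I_(4 + 3)).
Definition xi_of (s : 'I_3) : vfield G := e (rshift 4 s : 'I_(4 + 3)).
Definition hframe_of (a : 'I_4) : vfield G := e (lshift 3 a : 'I_(4 + 3)).

Local Notation "'''e' i j" := (wedge (th (i7 i)) (th (i7 j)))
  (at level 8, i at level 1, j at level 1).

Definition omega_of (s : 'I_3) : twoform G :=
  match val s with
  | 0 => ''e 1 2 + ''e 3 4
  | 1 => ''e 1 3 + ''e 4 2
  | _ => ''e 1 4 + ''e 2 3
  end.

Definition left_invariant_coframe : Prop :=
  is_coframe th e /\ forall i, left_invariant (th i).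

Definition heisenberg_equations : Prop :=
  (forall a : 'I_4, has_differential (th (lshift 3 a : 'I_(4 + 3))) 0) /\
  (forall s : 'I_3, has_differential (eta_of s) (2 *: omega_of s)).

Definition L2_equations : Prop :=
  has_differential (th (i7 1)) 0 /\
  has_differential (th (i7 2)) (- ''e 1 2 + ''e 3 4) /\
  has_differential (th (i7 3)) (- 2^-1 *: ''e 1 3) /\
  has_differential (th (i7 4)) (- 2^-1 *: ''e 1 4) /\
  has_differential (th (i7 5))
    (2 *: ''e 1 2 + 2 *: ''e 3 4 + ''e 3 7 - ''e 4 6 + 4^-1 *: ''e 6 7) /\
  has_differential (th (i7 6))
    (2 *: ''e 1 3 - 2 *: ''e 2 4 - 2^-1 *: ''e 2 7 + ''e 4 5
     - 4^-1 *: ''e 5 7) /\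
  has_differential (th (i7 7))
    (2 *: ''e 1 4 + 2 *: ''e 2 3 + 2^-1 *: ''e 2 6 - ''e 3 5
     + 4^-1 *: ''e 5 6).

(* e_1, ..., e_7 are orthonormal, and I_s is determined by
   g (I_s X, Y) = omega_s (X, Y) for X, Y in H. *)
Definition qc_of_coframe : qc_data G := QcData
  eta_of
  (fun p u v => \sum_(i < 7) th i p u * th i p v)
  (fun s p u => \sum_(a < 4) omega_of s p u (hframe_of a p) *: hframe_of a p)
  xi_of.

End Coframe7.

Definition locally_qc_conformally_flat (R : realType) (n : nat)
    (M : manifold R n) (eta : 'I_3 -> oneform M) : Prop :=
  exists (N : lieGroup R 7) (th : 'I_7 -> oneform N) (e : 'I_7 -> vfield N),
  [/\ simply_connected R N, left_invariant_coframe th e,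
      heisenberg_equations th
    & locally_qc_conformal eta (eta_of th)].

(* Main.v *)
Require Import Defs.
From mathcomp Require Import all_boot all_order all_algebra.
From mathcomp Require Import all_classical all_reals all_analysis.
From mathcomp Require Import ring lra.

Set Implicit Arguments.
Unset Strict Implicit.
Unset Printing Implicit Defensive.

Import Order.TTheory GRing.Theory Num.Theory.
Import numFieldNormedType.Exports.

Local Open Scope classical_set_scope.
Local Open Scope ring_scope.

(** The structure equations of the coframe turn every assertion into one about
    components, where brackets, connections and curvature have constant
    coefficients.

    For (a), the Biquard connection is the one whose horizontal part on H is the
    Levi-Civita connection of the horizontal structure constants, which is
    trivial along the Reeb fields, and which is carried to V by V = Q. It has the
    defining properties ([nabla_is_biquard]) with zero torsion endomorphism
    ([nabla_torsion_ver]), and no other connection has them ([nabla_unique]).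
    Its curvature is algebraic in the coefficients ([curvature_comp]); this gives
    S ([L2_qc_scalar]) and a nonzero value of W ([L2_W_neq0]).

    For (b), let F pull the Heisenberg contact form back to mu Psi eta, let
    theta' be the pulled back horizontal coframe, and let B be its matrix on H.
    Since a triple of 2-forms omega_s determines the metric, B is conformal:
    B^T B = mu ([conformal_orthogonal]). The mixed components of d eta' express
    the vertical part of theta' by the gradient v of (ln mu) / 2. Then
    d theta' = 0 prescribes the torsion of B^-1 dB, so that, as for the
    Levi-Civita connection, e_a B = B M_a with M_a affine in v ([koszul]).

    Now compute [e_a, e_b] B in two ways. For anti-self-dual combinations of the
    planes (a, b) the derivatives along the Reeb fields drop out because the
    forms d eta_s are self-dual on H. What remains equates an expression in v and
    its derivatives to zero. Its component in S^4 E, for the factor Sp(1) that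
    commutes with Q, contains neither v nor its derivatives: it is the constant
    - 3, essentially a component of W ([conf_Z_weyl]). This contradiction is the
    part of the conformal invariance of W that the theorem uses.

    Since F does not push global vector fields forward to global ones, pulling
    back is done on functions: the matrix of dF in the two frames is smooth
    ([jacobian_smooth]) and satisfies the pulled back structure equations
    ([jacobian_structure]). *)

(** * Smooth functions *)

Lemma near_open (T : topologicalType) (U : set T) (x : T) (P : T -> Prop) :
  open U -> U x -> (forall y, U y -> P y) -> \forall y \near x, P y.
Proof.
by move=> oU Ux UP; apply: filterS (open_nbhs_nbhs _) => [y|]; [exact: UP|split].
Qed.

Section Smooth.
Context (R : realType) (V : normedModType R).
Implicit Types (U : set V) (f g : V -> R^o).

(** Smoothness quantifies over all iterated derivatives, and a derivative only
    depends on the function up to equality on U: it is enough to find a class of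
    continuous, derivable functions that is stable under derivation. *)
Lemma smooth_on_coind U (P : (V -> R^o) -> Prop) : open U ->
  (forall f, P f ->
     [/\ forall x, U x -> {for x, continuous f},
         forall x v, U x -> derivable f x v
       & forall v, exists2 g, P g & forall x, U x -> 'D_v f x = g x]) ->
  forall f, P f -> smooth_on U f.
Proof.
move=> oU PP f Pf s.
have [g Pg fg] : exists2 g, P g & forall x, U x -> iter_derive s f x = g x.
  elim: s => [|v s [g Pg sg]]; first by exists f.
  have [_ _ /(_ v)[k Pk gk]] := PP _ Pg.
  exists k => // x Ux; rewrite /= -gk//.
  apply: near_eq_derive => //; exact: near_open Ux _.
move=> x Ux.
have [cg dg _] := PP _ Pg.
have fgx : \forall y \near x, iter_derive s f y = g y by exact: near_open Ux _.
have gfx : \forall y \near x, g y = iter_derive s f y.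
  by apply: filterS fgx.
split.
  rewrite /prop_for /continuous_at fg//.
  apply: cvg_trans (cg _ Ux); exact: near_eq_cvg.
by move=> v; exact: near_eq_derivable (dg x v Ux).
Qed.

(** Stable under directional derivatives by the Leibniz and quotient rules, so
    that one coinduction proves smoothness for all field operations at once. *)
Inductive field_closure U : (V -> R^o) -> Prop :=
| closure_base f : smooth_on U f -> field_closure U f
| closure_cst (c : R^o) : field_closure U (fun=> c)
| closure_add f g : field_closure U f -> field_closure U g ->
    field_closure U (fun x => f x + g x)
| closure_mul f g : field_closure U f -> field_closure U g ->
    field_closure U (fun x => f x * g x)
| closure_inv f : field_closure U f -> (forall x, U x -> f x != 0) ->
    field_closure U (fun x => (f x)^-1).

Lemma smooth_on_derive U f v : smooth_on U f -> smooth_on U ('D_v f).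
Proof. by move=> sf s; have := sf (rcons s v); rewrite /iter_derive foldr_rcons. Qed.

Lemma field_closure_smooth U f : open U -> field_closure U f -> smooth_on U f.
Proof.
move=> oU; apply: smooth_on_coind => // {}f; elim => {f}.
- move=> f sf; split=> [x Ux|x v Ux|v].
  + exact: (sf [::] x Ux).1.
  + exact: (sf [::] x Ux).2.
  + by exists ('D_v f) => //; apply: closure_base; exact: smooth_on_derive.
- move=> c; split=> [x Ux|x v Ux|v].
  + exact: cst_continuous.
  + exact: derivable_cst.
  + by exists (fun=> 0); [exact: closure_cst|move=> x Ux; exact: derive_cst].
- move=> f g Af [cf df Df] Ag [cg dg Dg]; split=> [x Ux|x v Ux|v].
  + by apply: cvgD; [exact: cf|exact: cg].
  + by apply: derivableD; [exact: df|exact: dg].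
  + have [f' Af' Df'] := Df v; have [g' Ag' Dg'] := Dg v.
    exists (fun x => f' x + g' x); first exact: closure_add.
    move=> x Ux; rewrite -Df'// -Dg'//.
    by apply: (@deriveD R V R^o f g); [exact: df|exact: dg].
- move=> f g Af [cf df Df] Ag [cg dg Dg]; split=> [x Ux|x v Ux|v].
  + by apply: cvgM; [exact: cf|exact: cg].
  + by apply: (@derivableM R V f g); [exact: df|exact: dg].
  + have [f' Af' Df'] := Df v; have [g' Ag' Dg'] := Dg v.
    exists (fun x => f x * g' x + g x * f' x).
      by apply: closure_add; exact: closure_mul.
    move=> x Ux; rewrite -Df'// -Dg'//.
    by rewrite (@deriveM R V f g)//; [exact: df|exact: dg].
- move=> f Af [cf df Df] f0; split=> [x Ux|x v Ux|v].
  + by apply: cvgV; [exact: f0|exact: cf].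
  + by apply: (@derivableV R V f); [exact: f0|exact: df].
  + have [f' Af' Df'] := Df v.
    exists (fun x => (-1) * ((f x)^-1 * (f x)^-1) * f' x).
      by do 2?[apply: closure_mul => //];
        [exact: closure_cst|apply: closure_mul; exact: closure_inv].
    move=> x Ux; rewrite -Df'//.
    rewrite (@deriveV R V f)//; [|exact: f0|exact: df].
    by rewrite -exprVn expr2 mulN1r.
Qed.

End Smooth.

Section SmoothNear.
Context (R : realType) (V : normedModType R).
Implicit Types (U : set V) (f g : V -> R^o) (x : V).

Lemma nbhs_openP (x : V) (P : set V) : nbhs x P ->
  exists W : set V, [/\ open W, W x & forall y, W y -> P y].
Proof. by rewrite nbhsE => -[W [oW Wx] WP]; exists W. Qed.

Lemma iter_derive_eq U f g s : open U -> (forall x, U x -> f x = g x) ->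
  forall x, U x -> iter_derive s f x = iter_derive s g x.
Proof.
move=> oU fg; elim: s => [|v s IH] x Ux; first exact: fg.
by apply: near_eq_derive; exact: near_open Ux IH.
Qed.

Lemma smooth_on_eq U f g : open U -> (forall x, U x -> f x = g x) ->
  smooth_on U f -> smooth_on U g.
Proof.
move=> oU fg sf s x Ux; have [cf df] := sf s x Ux.
have fgs := iter_derive_eq s oU fg.
have nfg := near_open oU Ux fgs.
split=> [|v]; last exact: near_eq_derivable (df v).
rewrite /prop_for /continuous_at -fgs//.
by apply: cvg_trans cf; apply: near_eq_cvg; apply: filterS nfg.
Qed.

Lemma smooth_near_eq x f g : smooth_near x f -> (\near x, f x = g x) ->
  smooth_near x g.
Proof.
move=> [U [oU Ux sf]] /nbhs_openP[W [oW Wx fg]].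
exists (U `&` W); split; [exact: openI|by []|].
apply: (@smooth_on_eq _ f); [exact: openI|by move=> y [_ /fg]|].
by move=> s y [Uy _]; exact: sf.
Qed.

Lemma smooth_near_cst x (c : R^o) : smooth_near x (fun=> c).
Proof.
exists setT; split=> //; first exact: openT.
by apply: field_closure_smooth; [exact: openT|exact: closure_cst].
Qed.

Lemma smooth_near_op (F : R^o -> R^o -> R^o) :
  (forall U f g, smooth_on U f -> smooth_on U g ->
    field_closure U (fun x => F (f x) (g x))) ->
  forall x f g, smooth_near x f -> smooth_near x g ->
    smooth_near x (fun x => F (f x) (g x)).
Proof.
move=> HF x f g [U [oU Ux sf]] [W [oW Wx sg]].
have oUW : open (U `&` W) by exact: openI.
exists (U `&` W); split => //; apply: field_closure_smooth => //.
by apply: HF => s y [Uy Wy]; [exact: sf|exact: sg].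
Qed.

Lemma smooth_nearD x f g : smooth_near x f -> smooth_near x g ->
  smooth_near x (fun x => f x + g x).
Proof.
by apply: (@smooth_near_op (fun a b => a + b)) => *; apply: closure_add;
  exact: closure_base.
Qed.

Lemma smooth_nearM x f g : smooth_near x f -> smooth_near x g ->
  smooth_near x (fun x => f x * g x).
Proof.
by apply: (@smooth_near_op (fun a b => a * b)) => *; apply: closure_mul;
  exact: closure_base.
Qed.

Lemma smooth_near_continuous x f : smooth_near x f -> {for x, continuous f}.
Proof. by move=> [U [_ Ux sf]]; exact: (sf [::] x Ux).1. Qed.

Lemma smooth_nearV x f : smooth_near x f -> f x != 0 ->
  smooth_near x (fun x => (f x)^-1).
Proof.
move=> sfx fx0; have cf := smooth_near_continuous sfx.
have [U [oU Ux sf]] := sfx.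
have : nbhs x [set y | f y != 0].
  apply: (cf [set z : R | z != 0]).
  by apply: open_nbhs_nbhs; split=> //; exact: open_neq.
move=> /nbhs_openP[W [oW Wx Wf]].
have oUW : open (U `&` W) by exact: openI.
exists (U `&` W); split=> //; apply: field_closure_smooth => //.
apply: closure_inv; last by move=> y [_ /Wf].
by apply: closure_base => s y [Uy _]; exact: sf.
Qed.

End SmoothNear.

Section SmoothAt.
Context (R : realType) (n : nat) (M : manifold R n).
Implicit Types (p q : M) (f g : M -> R).

Lemma near_nbhs p (P : M -> Prop) : (\forall q \near p, P q) ->
  \forall q \near p, \forall r \near q, P r.
Proof. by move=> /nbhs_interior. Qed.

Lemma smooth_at_near p f : smooth_at p f -> \forall q \near p, smooth_at q f.
Proof. exact: near_nbhs. Qed.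

Lemma chart_inv_near p (c : chart R n M) (P : M -> Prop) :
  atlas c -> chart_dom c p -> (\forall q \near p, P q) ->
  \forall y \near chart_map c p, P (chart_inv c y).
Proof.
move=> /atlas_chart[_ _ cK _ cc] cp Pp; apply: (cc p cp).
by rewrite cK.
Qed.

Lemma smooth_at_eq p f g : smooth_at p f -> (\forall q \near p, f q = g q) ->
  smooth_at p g.
Proof.
move=> sf /near_nbhs fg; apply: filterS2 sf fg => q sf fg c ac cq.
by apply: smooth_near_eq (sf c ac cq) _; exact: chart_inv_near fg.
Qed.

Lemma smooth_at_continuous p f : smooth_at p f -> {for p, continuous f}.
Proof.
move=> /nbhs_singleton sf; have [c [ac cp]] := atlas_cover p.
have [od _ cK cc _] := atlas_chart ac.
have := smooth_near_continuous (sf c ac cp).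
rewrite /prop_for /continuous_at cK// => h.
have := cvg_comp _ _ (cc p cp) h; apply: cvg_trans.
by apply: near_eq_cvg; apply: near_open cp _ => // q cq /=; rewrite cK.
Qed.

Lemma smooth_at_cst p (c : R) : smooth_at p (fun=> c).
Proof. by apply: nearW => q d _ _; exact: smooth_near_cst. Qed.

Lemma smooth_atD p f g : smooth_at p f -> smooth_at p g ->
  smooth_at p (fun x => f x + g x).
Proof.
move=> sf sg; apply: filterS2 sf sg => q sf sg c ac cq.
exact: smooth_nearD (sf c ac cq) (sg c ac cq).
Qed.

Lemma smooth_atM p f g : smooth_at p f -> smooth_at p g ->
  smooth_at p (fun x => f x * g x).
Proof.
move=> sf sg; apply: filterS2 sf sg => q sf sg c ac cq.
exact: smooth_nearM (sf c ac cq) (sg c ac cq).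
Qed.

Lemma smooth_at_neq0 p f : smooth_at p f -> f p != 0 ->
  \forall q \near p, f q != 0.
Proof.
move=> /smooth_at_continuous cf fp0; have : nbhs (f p) [set z : R | z != 0].
  by apply: open_nbhs_nbhs; split=> //; exact: open_neq.
by move=> /cf.
Qed.

Lemma smooth_atV p f : smooth_at p f -> f p != 0 ->
  smooth_at p (fun x => (f x)^-1).
Proof.
move=> sf fp0; have f0 := smooth_at_neq0 sf fp0.
apply: filterS2 sf f0 => q sf fq c ac cq.
apply: smooth_nearV; first exact: sf.
by have [_ _ ->] := atlas_chart ac.
Qed.

Lemma smooth_at_sum p (I : Type) (r : seq I) (P : pred I) (F : I -> M -> R) :
  (forall i, P i -> smooth_at p (F i)) ->
  smooth_at p (fun x => \sum_(i <- r | P i) F i x).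
Proof.
move=> sF; elim: r => [|i r IH].
  by apply: smooth_at_eq (smooth_at_cst p 0) _; apply: nearW => x; rewrite big_nil.
have [Pi|nPi] := boolP (P i).
  apply: smooth_at_eq (smooth_atD (sF i Pi) IH) _.
  by apply: nearW => x; rewrite big_cons Pi.
by apply: smooth_at_eq IH _; apply: nearW => x; rewrite big_cons (negbTE nPi).
Qed.

Lemma smooth_at_prod p (I : Type) (r : seq I) (P : pred I) (F : I -> M -> R) :
  (forall i, P i -> smooth_at p (F i)) ->
  smooth_at p (fun x => \prod_(i <- r | P i) F i x).
Proof.
move=> sF; elim: r => [|i r IH].
  by apply: smooth_at_eq (smooth_at_cst p 1) _; apply: nearW => x; rewrite big_nil.
have [Pi|nPi] := boolP (P i).
  apply: smooth_at_eq (smooth_atM (sF i Pi) IH) _.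
  by apply: nearW => x; rewrite big_cons Pi.
by apply: smooth_at_eq IH _; apply: nearW => x; rewrite big_cons (negbTE nPi).
Qed.

Lemma smooth_at_det p m (F : M -> 'M[R]_m) :
  (forall i j, smooth_at p (fun x => F x i j)) ->
  smooth_at p (fun x => \det (F x)).
Proof.
move=> sF; apply: smooth_at_sum => s _; apply: smooth_atM.
  exact: smooth_at_cst.
by apply: smooth_at_prod => i _; exact: sF.
Qed.

(** Cramer's rule. *)
Lemma smooth_at_invmx p m (F : M -> 'M[R]_m) :
  (forall i j, smooth_at p (fun x => F x i j)) -> F p \in unitmx ->
  forall i j, smooth_at p (fun x => invmx (F x) i j).
Proof.
move=> sF Fp i j.
have sd := smooth_at_det sF.
have dp : \det (F p) != 0 by move: Fp; rewrite unitmxE unitfE.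
have d0 := smooth_at_neq0 sd dp.
apply: (@smooth_at_eq _ (fun x => (\det (F x))^-1 * \adj (F x) i j)).
  apply: smooth_atM; first exact: smooth_atV.
  apply: (@smooth_at_eq _ (fun x => cofactor (F x) j i)); last first.
    by apply: nearW => x; rewrite mxE.
  apply: smooth_atM; first exact: smooth_at_cst.
  apply: smooth_at_det => k l.
  apply: smooth_at_eq (sF (lift j k) (lift i l)) _.
  by apply: nearW => x; rewrite !mxE.
apply: filterS d0 => x dx.
by rewrite /invmx unitmxE unitfE dx [RHS]mxE.
Qed.

End SmoothAt.

(* Unification would otherwise compare functions by unfolding their germs. *)
Opaque smooth_at.

(** * Tangent vectors and vector fields *)

Section TangentVectors.
Context (R : realType) (n : nat) (M : manifold R n).
Implicit Types (p q : M) (f g : M -> R) (u v : tvec M).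

Lemma tvecDE u v f : (u + v) f = u f + v f. Proof. by []. Qed.
Lemma tvecZE (a : R) v f : (a *: v) f = a * v f. Proof. by []. Qed.
Lemma tvec_sumE (I : Type) (r : seq I) (P : pred I) (F : I -> tvec M) f :
  (\sum_(i <- r | P i) F i) f = \sum_(i <- r | P i) F i f.
Proof.
apply: (big_morph (fun u : tvec M => u f : R)) => //.
Qed.

Lemma tangent0 p : tangent p (0 : tvec M).
Proof.
split=> //.
- by move=> a f h _ _; rewrite mulr0 addr0.
- by move=> f h _ _; rewrite mul0r mulr0 addr0.
Qed.

Lemma tangentZD p (a : R) u v : tangent p u -> tangent p v ->
  tangent p (a *: u + v).
Proof.
move=> [ul uL ug uj] [vl vL vg vj]; split.
- move=> b f h sf sh; rewrite !tvecDE !tvecZE ul// vl//; ring.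
- move=> f h sf sh; rewrite !tvecDE !tvecZE uL// vL//; ring.
- move=> f h sf fh; rewrite !tvecDE !tvecZE.
  by congr (_ * _ + _); [exact: ug|exact: vg].
- by move=> f nsf; rewrite !tvecDE !tvecZE uj// vj// mulr0 addr0.
Qed.

Lemma tangentZ p (a : R) u : tangent p u -> tangent p (a *: u).
Proof. by move=> tu; rewrite -[_ *: _]addr0; apply: tangentZD (tangent0 p). Qed.

Lemma tangentD p u v : tangent p u -> tangent p v -> tangent p (u + v).
Proof. by move=> tu tv; rewrite -[u]scale1r; exact: tangentZD. Qed.

Lemma tangentN p u : tangent p u -> tangent p (- u).
Proof. by rewrite -scaleN1r; exact: tangentZ. Qed.

Lemma tangentB p u v : tangent p u -> tangent p v -> tangent p (u - v).
Proof. by move=> tu /tangentN; exact: tangentD. Qed.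

Lemma tangent_sum p (I : Type) (r : seq I) (P : pred I) (F : I -> tvec M) :
  (forall i, P i -> tangent p (F i)) -> tangent p (\sum_(i <- r | P i) F i).
Proof.
move=> tF; elim/big_ind : _ => //; [exact: tangent0|].
by move=> u v; exact: tangentD.
Qed.

Section Rules.
Context (p : M) (v : tvec M).
Hypothesis tv : tangent p v.

Lemma tangent_cst (c : R) : v (fun=> c) = 0.
Proof.
have s0 := smooth_at_cst p 0; have s1 := smooth_at_cst p 1.
have v1 : v (fun=> 1) = 0.
  have := tangent_leibniz tv s1 s1.
  rewrite (_ : (fun=> 1 * 1) = (fun=> 1)); last by apply/funext => x; rewrite mulr1.
  by rewrite mulr1 mul1r => h; apply: (addrI (v (fun=> 1))); rewrite addr0 -h.
have v0 : v (fun=> 0) = 0.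
  have := tangent_linear tv 1 s0 s0.
  rewrite (_ : (fun=> 1 * 0 + 0) = (fun=> 0)); last first.
    by apply/funext => x; rewrite mulr0 addr0.
  by rewrite mul1r => h; apply: (addrI (v (fun=> 0))); rewrite addr0 -h.
have := tangent_linear tv c s1 s0.
rewrite v1 v0 mulr0 [RHS]addr0 => <-; congr v.
by apply/funext => x; rewrite mulr1 addr0.
Qed.

Lemma tangent_add f g : smooth_at p f -> smooth_at p g ->
  v (fun x => f x + g x) = v f + v g.
Proof.
move=> sf sg; have := tangent_linear tv 1 sf sg; rewrite mul1r => <-.
by congr v; apply/funext => x; rewrite mul1r.
Qed.

Lemma tangent_scale (c : R) f : smooth_at p f -> v (fun x => c * f x) = c * v f.
Proof.
move=> sf; have := tangent_linear tv c sf (smooth_at_cst p 0).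
rewrite tangent_cst [RHS]addr0 => <-.
by congr v; apply/funext => x; rewrite addr0.
Qed.

Lemma tangent_bigsum (I : Type) (r : seq I) (F : I -> M -> R) :
  (forall i, smooth_at p (F i)) ->
  v (fun x => \sum_(i <- r) F i x) = \sum_(i <- r) v (F i).
Proof.
move=> sF; elim: r => [|i r IH].
  rewrite big_nil -[RHS](tangent_cst 0); congr v.
  by apply/funext => x; rewrite big_nil.
rewrite big_cons -IH -tangent_add//; last exact: smooth_at_sum.
by congr v; apply/funext => x; rewrite big_cons.
Qed.

End Rules.

(** Smooth maps pull smooth germs back to smooth germs, so that a derivation at
    p becomes one at F p. *)
Lemma differential_tangent (m : nat) (N : manifold R m) (F : M -> N) p v :
  smooth_map_at F p -> tangent p v -> tangent (F p) (differential F p v).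
Proof.
move=> [cF sF] tv.
have E k : smooth_at (F p) k -> differential F p v k = v (k \o F).
  by move=> sf; rewrite /differential; case: asboolP.
split.
- move=> a k h sk sh.
  have skh := smooth_atD (smooth_atM (smooth_at_cst (F p) a) sk) sh.
  rewrite (E _ skh) (E _ sk) (E _ sh).
  exact: (tangent_linear tv a (sF k sk) (sF h sh)).
- move=> k h sk sh.
  rewrite (E _ (smooth_atM sk sh)) (E _ sk) (E _ sh).
  exact: (tangent_leibniz tv (sF k sk) (sF h sh)).
- move=> k h sk kh.
  rewrite (E _ sk) (E _ (smooth_at_eq sk kh)).
  apply: (tangent_germ tv); first exact: sF.
  exact: cF kh.
- by move=> k nsk; rewrite /differential; case: asboolP.
Qed.

End TangentVectors.

Section VectorFields.
Context (R : realType) (n : nat) (M : manifold R n).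
Implicit Types (p q : M) (f g : M -> R) (X Y : vfield M).

Lemma smooth_vf_comb (I : Type) (r : seq I) (f : I -> M -> R) (X : I -> vfield M) :
  (forall i, smooth_fun (f i)) -> (forall i, smooth_vf (X i)) ->
  smooth_vf (fun p => \sum_(i <- r) f i p *: X i p).
Proof.
move=> sf sX; split=> p.
  by apply: tangent_sum => i _; apply: tangentZ; exact: (sX i).1.
move=> h sh; apply: (@smooth_at_eq _ _ _ _
  (fun q => \sum_(i <- r) f i q * vf_app (X i) h q)).
  by apply: smooth_at_sum => i _; apply: smooth_atM; [exact: sf|exact: (sX i).2].
by apply: nearW => q; rewrite /vf_app tvec_sumE.
Qed.

Lemma bracketE X Y p f : smooth_at p f ->
  bracket X Y p f = X p (vf_app Y f) - Y p (vf_app X f).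
Proof. by move=> sf; rewrite /bracket; case: asboolP. Qed.

Lemma vf_app_near_eq X p f g : smooth_vf X -> smooth_at p f ->
  (\forall q \near p, f q = g q) -> \forall q \near p, vf_app X f q = vf_app X g q.
Proof.
move=> sX /smooth_at_near sf /near_nbhs fg.
by apply: filterS2 sf fg => q sf fg; rewrite /vf_app (tangent_germ (sX.1 q) sf fg).
Qed.

Lemma vf_app_linear X p (a : R) f g : smooth_vf X -> smooth_at p f -> smooth_at p g ->
  \forall q \near p, vf_app X (fun x => a * f x + g x) q =
    a * vf_app X f q + vf_app X g q.
Proof.
move=> sX /smooth_at_near sf /smooth_at_near sg.
by apply: filterS2 sf sg => q sf sg; rewrite /vf_app (tangent_linear (sX.1 q) a sf sg).
Qed.

Lemma vf_app_leibniz X p f g : smooth_vf X -> smooth_at p f -> smooth_at p g ->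
  \forall q \near p, vf_app X (fun x => f x * g x) q =
    vf_app X f q * g q + f q * vf_app X g q.
Proof.
move=> sX /smooth_at_near sf /smooth_at_near sg.
by apply: filterS2 sf sg => q sf sg; rewrite /vf_app (tangent_leibniz (sX.1 q) sf sg).
Qed.

(** The terms with one derivative of each factor cancel in the commutator. *)
Lemma bracket_tangent X Y p : smooth_vf X -> smooth_vf Y ->
  tangent p (bracket X Y p).
Proof.
move=> sX sY; have tX := sX.1 p; have tY := sY.1 p.
split.
- move=> a f g sf sg.
  have sfg := smooth_atD (smooth_atM (smooth_at_cst p a) sf) sg.
  rewrite (bracketE _ _ sfg) (bracketE _ _ sf) (bracketE _ _ sg).
  have step (Z Z' : vfield M) : smooth_vf Z -> smooth_vf Z' ->
    Z p (vf_app Z' (fun x => a * f x + g x)) =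
    a * Z p (vf_app Z' f) + Z p (vf_app Z' g).
    move=> sZ sZ'.
    rewrite -(tangent_linear (sZ.1 p) a (sZ'.2 p f sf) (sZ'.2 p g sg)).
    by apply: (tangent_germ (sZ.1 p)); [exact: sZ'.2|exact: vf_app_linear].
  rewrite (step X Y sX sY) (step Y X sY sX); ring.
- move=> f g sf sg.
  have sfg := smooth_atM sf sg.
  rewrite (bracketE _ _ sfg) (bracketE _ _ sf) (bracketE _ _ sg).
  have step (Z Z' : vfield M) : smooth_vf Z -> smooth_vf Z' ->
    Z p (vf_app Z' (fun x => f x * g x)) =
    Z p (vf_app Z' f) * g p + Z' p f * Z p g +
      (Z p f * Z' p g + f p * Z p (vf_app Z' g)).
    move=> sZ sZ'.
    have sZf := sZ'.2 p f sf; have sZg := sZ'.2 p g sg.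
    rewrite -(tangent_leibniz (sZ.1 p) sZf sg) -(tangent_leibniz (sZ.1 p) sf sZg).
    rewrite -(tangent_add (sZ.1 p) (smooth_atM sZf sg) (smooth_atM sf sZg)).
    by apply: (tangent_germ (sZ.1 p)); [exact: sZ'.2|exact: vf_app_leibniz].
  rewrite (step X Y sX sY) (step Y X sY sX); ring.
- move=> f g sf fg; have sg := smooth_at_eq sf fg.
  rewrite (bracketE _ _ sf) (bracketE _ _ sg); congr (_ - _).
    by apply: (tangent_germ tX); [exact: sY.2|exact: vf_app_near_eq].
  by apply: (tangent_germ tY); [exact: sX.2|exact: vf_app_near_eq].
- by move=> f nsf; rewrite /bracket; case: asboolP.
Qed.

End VectorFields.

(** * Calculus in a global frame *)

Section Frame.
Context (R : realType) (n : nat) (M : manifold R n).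
Context (th : 'I_n -> oneform M) (e : 'I_n -> vfield M).
Hypothesis coframe : is_coframe th e.
Implicit Types (p q : M) (f g : M -> R) (u v : tvec M) (A B C X Y : vfield M).

Let th_smooth i : smooth_form (th i). Proof. by case: coframe. Qed.

Lemma frame_smooth i : smooth_vf (e i). Proof. by case: coframe. Qed.

Lemma frame_tangent i p : tangent p (e i p). Proof. exact: (frame_smooth i).1. Qed.

Lemma coframe_frame i j p : th i p (e j p) = (i == j)%:R.
Proof. by case: coframe. Qed.

Lemma frame_expand p v : tangent p v -> v = \sum_(i < n) th i p v *: e i p.
Proof. by case: coframe => _ _ _; apply. Qed.

Lemma coframe_linear i p (a : R) u v : tangent p u -> tangent p v ->
  th i p (a *: u + v) = a * th i p u + th i p v.
Proof. exact: (th_smooth i).1. Qed.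

Lemma coframe_D i p u v : tangent p u -> tangent p v ->
  th i p (u + v) = th i p u + th i p v.
Proof. by move=> tu tv; rewrite -[u]scale1r coframe_linear// scale1r mul1r. Qed.

Lemma coframe0 i p : th i p 0 = 0.
Proof.
have := coframe_D i (tangent0 p) (tangent0 p); rewrite addr0 => h.
by apply: (addrI (th i p 0)); rewrite addr0 -h.
Qed.

Lemma coframe_Z i p (a : R) u : tangent p u -> th i p (a *: u) = a * th i p u.
Proof.
move=> tu; rewrite -[a *: u]addr0 (coframe_linear i a tu (tangent0 p)).
by rewrite coframe0 addr0.
Qed.

Lemma coframe_N i p u : tangent p u -> th i p (- u) = - th i p u.
Proof. by move=> tu; rewrite -scaleN1r coframe_Z// mulN1r. Qed.

Lemma coframe_B i p u v : tangent p u -> tangent p v ->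
  th i p (u - v) = th i p u - th i p v.
Proof. by move=> tu tv; rewrite coframe_D ?coframe_N//; exact: tangentN. Qed.

Lemma coframe_sum i p (I : Type) (r : seq I) (F : I -> tvec M) :
  (forall j, tangent p (F j)) ->
  th i p (\sum_(j <- r) F j) = \sum_(j <- r) th i p (F j).
Proof.
move=> tF; elim: r => [|j r IH]; first by rewrite !big_nil coframe0.
by rewrite !big_cons coframe_D ?IH//; exact: tangent_sum.
Qed.

Lemma tangent_comb p (c : 'I_n -> R) : tangent p (\sum_(k < n) c k *: e k p).
Proof. by apply: tangent_sum => k _; apply: tangentZ; exact: frame_tangent. Qed.

Lemma coframe_comb i p (c : 'I_n -> R) : th i p (\sum_(k < n) c k *: e k p) = c i.
Proof.
rewrite coframe_sum; last by move=> j; apply: tangentZ; exact: frame_tangent.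
rewrite (bigD1 i)//= coframe_Z; last exact: frame_tangent.
rewrite coframe_frame eqxx mulr1 big1 ?addr0// => j ji.
rewrite coframe_Z; last exact: frame_tangent.
by rewrite coframe_frame eq_sym (negbTE ji) mulr0.
Qed.

Lemma tangent_ext p u v : tangent p u -> tangent p v ->
  (forall i, th i p u = th i p v) -> u = v.
Proof.
move=> tu tv uv; rewrite (frame_expand tu) (frame_expand tv).
by apply: eq_bigr => i _; rewrite uv.
Qed.

Lemma tangent_expand p v f : tangent p v -> v f = \sum_(i < n) th i p v * e i p f.
Proof. by move=> /frame_expand {1}->; rewrite tvec_sumE. Qed.

Lemma comp_smooth i A : smooth_vf A -> smooth_fun (fun p => th i p (A p)).
Proof. exact: (th_smooth i).2. Qed.

Lemma comb_smooth (c : 'I_n -> M -> R) : (forall k, smooth_fun (c k)) ->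
  smooth_vf (fun p => \sum_(k < n) c k p *: e k p).
Proof. by move=> sc; exact: smooth_vf_comb sc frame_smooth. Qed.

Lemma smooth_vf_comps A : (forall p, tangent p (A p)) ->
  (forall i, smooth_fun (fun p => th i p (A p))) -> smooth_vf A.
Proof.
move=> tA sA; rewrite (_ : A = fun p => \sum_(k < n) th k p (A p) *: e k p).
  exact: comb_smooth.
by apply/funext => p; exact: frame_expand.
Qed.

(** Cartan's formula read backwards: the structure equations of a coframe give
    the components of all brackets. *)
Lemma bracket_comp (k : 'I_n) (w : twoform M) A B p :
  has_differential (th k) w -> smooth_vf A -> smooth_vf B ->
  th k p (bracket A B p) =
  A p (fun q => th k q (B q)) - B p (fun q => th k q (A q)) - w p (A p) (B p).
Proof.
move=> dth sA sB; have := dth A B sA sB p; rewrite /dform => <-; ring.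
Qed.

Definition bilin (Gam : 'I_n -> 'I_n -> 'I_n -> R) (x y : 'I_n -> R) (k : 'I_n) : R :=
  \sum_(i < n) \sum_(j < n) Gam i j k * (x i * y j).

Lemma bilin_linearl Gam (a : R) x x' y k :
  bilin Gam (fun i => a * x i + x' i) y k = a * bilin Gam x y k + bilin Gam x' y k.
Proof.
rewrite /bilin mulr_sumr -big_split; apply: eq_bigr => i _ /=.
rewrite mulr_sumr -big_split; apply: eq_bigr => j _ /=; ring.
Qed.

Lemma bilin_linearr Gam (a : R) x y y' k :
  bilin Gam x (fun i => a * y i + y' i) k = a * bilin Gam x y k + bilin Gam x y' k.
Proof.
rewrite /bilin mulr_sumr -big_split; apply: eq_bigr => i _ /=.
rewrite mulr_sumr -big_split; apply: eq_bigr => j _ /=; ring.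
Qed.

Lemma bilin_smooth Gam (x y : M -> 'I_n -> R) k p :
  (forall i, smooth_at p (x ^~ i)) -> (forall i, smooth_at p (y ^~ i)) ->
  smooth_at p (fun q => bilin Gam (x q) (y q) k).
Proof.
move=> sx sy; apply: smooth_at_sum => i _; apply: smooth_at_sum => j _.
apply: smooth_atM; [exact: smooth_at_cst|].
exact: smooth_atM.
Qed.

Lemma bilin_derive Gam (x y : M -> 'I_n -> R) k p v : tangent p v ->
  (forall i, smooth_at p (x ^~ i)) -> (forall i, smooth_at p (y ^~ i)) ->
  v (fun q => bilin Gam (x q) (y q) k) =
  bilin Gam (fun i => v (x ^~ i)) (y p) k + bilin Gam (x p) (fun i => v (y ^~ i)) k.
Proof.
move=> tv sx sy.
have sxy i j := smooth_atM (sx i) (sy j).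
have sG i j := smooth_atM (smooth_at_cst p (Gam i j k)) (sxy i j).
rewrite (tangent_bigsum tv) => [|i]; last by apply: smooth_at_sum => j _; exact: sG.
rewrite /bilin -big_split; apply: eq_bigr => i _ /=.
rewrite (tangent_bigsum tv) => [|j]; last exact: sG.
rewrite -big_split; apply: eq_bigr => j _ /=.
rewrite (tangent_scale tv _ (sxy i j)) (tangent_leibniz tv (sx i) (sy j)); ring.
Qed.

Definition coframe_comps p v : 'I_n -> R := fun i => th i p v.

Lemma comps_frame p i : coframe_comps p (e i p) = fun j => (j == i)%:R.
Proof. by apply/funext => j; exact: coframe_frame. Qed.

Definition frame_conn Gam A B : vfield M := fun p =>
  \sum_(k < n) (A p (fun q => th k q (B q)) +
     bilin Gam (coframe_comps p (A p)) (coframe_comps p (B p)) k) *: e k p.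

Lemma frame_conn_comp Gam A B k p : th k p (frame_conn Gam A B p) =
  A p (fun q => th k q (B q)) + bilin Gam (coframe_comps p (A p))
    (coframe_comps p (B p)) k.
Proof. by rewrite /frame_conn coframe_comb. Qed.

Lemma frame_conn_smooth Gam A B : smooth_vf A -> smooth_vf B ->
  smooth_vf (frame_conn Gam A B).
Proof.
move=> sA sB; apply: comb_smooth => k p; apply: smooth_atD.
  exact: (sA.2 p _ (comp_smooth k sB p)).
by apply: bilin_smooth => i; exact: comp_smooth.
Qed.

Lemma smooth_vf_scale f A : smooth_fun f -> smooth_vf A -> smooth_vf (vf_scale f A).
Proof.
move=> sf sA; split=> [p|p g sg]; first exact: tangentZ (sA.1 p).
exact: smooth_atM (sf p) (sA.2 p g sg).
Qed.

Lemma frame_conn_is_connection Gam : is_connection (frame_conn Gam).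
Proof.
split.
- by move=> A B; exact: frame_conn_smooth.
- move=> f A A' B sf sA sA' sB; apply/funext => p.
  apply: (@tangent_ext p).
  + exact: tangent_comb.
  + by apply: tangentD; [apply: tangentZ|]; exact: tangent_comb.
  move=> k; rewrite /vf_add/vf_scale coframe_linear; try exact: tangent_comb.
  rewrite !frame_conn_comp (_ : coframe_comps p _ =
    fun i => f p * coframe_comps p (A p) i + coframe_comps p (A' p) i); last first.
    by apply/funext => i; exact: coframe_linear (sA.1 p) (sA'.1 p).
  rewrite bilin_linearl tvecDE tvecZE; ring.
- move=> A B B' sA sB sB'; apply/funext => p.
  apply: (@tangent_ext p).
  + exact: tangent_comb.
  + by apply: tangentD; exact: tangent_comb.
  move=> k; rewrite /vf_add coframe_D; try exact: tangent_comb.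
  rewrite !frame_conn_comp (_ : (fun q => th k q (B q + B' q)) =
    fun q => th k q (B q) + th k q (B' q)); last first.
    by apply/funext => q; exact: coframe_D (sB.1 q) (sB'.1 q).
  rewrite (tangent_add (sA.1 p) (comp_smooth k sB p) (comp_smooth k sB' p)).
  rewrite (_ : coframe_comps p (B p + _) =
    fun i => 1 * coframe_comps p (B p) i + coframe_comps p (B' p) i); last first.
    by apply/funext => i; rewrite mul1r; exact: coframe_D (sB.1 p) (sB'.1 p).
  rewrite bilin_linearr; ring.
- move=> f A B sf sA sB; apply/funext => p.
  have tB := sB.1 p.
  apply: (@tangent_ext p).
  + exact: tangent_comb.
  + by apply: tangentD; apply: tangentZ => //; exact: tangent_comb.
  move=> k; rewrite /vf_add/vf_scale coframe_linear//; last first.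
    by apply: tangentZ; exact: tangent_comb.
  rewrite coframe_Z; last exact: tangent_comb.
  rewrite !frame_conn_comp (_ : (fun q => th k q (f q *: B q)) =
    fun q => f q * th k q (B q)); last first.
    by apply/funext => q; exact: coframe_Z (sB.1 q).
  rewrite (tangent_leibniz (sA.1 p) (sf p) (comp_smooth k sB p)).
  rewrite (_ : coframe_comps p (f p *: B p) =
    fun i => f p * coframe_comps p (B p) i + 0); last first.
    by apply/funext => i; rewrite addr0; exact: coframe_Z.
  rewrite bilin_linearr /vf_app.
  rewrite (_ : bilin Gam _ (fun=> 0) k = 0); last first.
    by rewrite /bilin big1// => i _; rewrite big1// => j _; rewrite !mulr0.
  ring.
Qed.

Section Structure.
Context (w : 'I_n -> ('I_n -> R) -> ('I_n -> R) -> R).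
Hypothesis dth : forall k,
  has_differential (th k) (fun p u v => w k (coframe_comps p u) (coframe_comps p v)).

Lemma frame_bracket k a b y : th k y (bracket (e a) (e b) y) =
  - w k (fun j => (j == a)%:R) (fun j => (j == b)%:R).
Proof.
have sa := frame_smooth a; have sb := frame_smooth b.
have K c : (fun q => th k q (e c q)) = fun=> (k == c)%:R.
  by apply/funext => q; exact: coframe_frame.
rewrite (bracket_comp y (dth k) sa sb) !K.
rewrite (tangent_cst (sa.1 y)) (tangent_cst (sb.1 y)).
by rewrite !comps_frame subrr sub0r.
Qed.

Lemma torsion_tangent Gam A B p : smooth_vf A -> smooth_vf B ->
  tangent p (torsion (frame_conn Gam) A B p).
Proof.
move=> sA sB; apply: tangentB; last exact: bracket_tangent.
by apply: tangentB; exact: tangent_comb.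
Qed.

Lemma torsion_comp Gam A B k p : smooth_vf A -> smooth_vf B ->
  th k p (torsion (frame_conn Gam) A B p) =
  bilin Gam (coframe_comps p (A p)) (coframe_comps p (B p)) k
  - bilin Gam (coframe_comps p (B p)) (coframe_comps p (A p)) k +
    w k (coframe_comps p (A p)) (coframe_comps p (B p)).
Proof.
move=> sA sB; have tb := bracket_tangent p sA sB.
rewrite /torsion coframe_B//; last by apply: tangentB; exact: tangent_comb.
rewrite coframe_B; try exact: tangent_comb.
rewrite !frame_conn_comp (bracket_comp p (dth k) sA sB); ring.
Qed.

(** The second derivatives of the components cancel by definition of the
    bracket, so that the curvature is an algebraic expression in the
    coefficients. *)
Lemma curvature_comp Gam A B C k p : smooth_vf A -> smooth_vf B -> smooth_vf C ->
  let x := coframe_comps p (A p) in let y := coframe_comps p (B p) in let z :=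
    coframe_comps p (C p) in
  th k p (curvature (frame_conn Gam) A B C p) =
  bilin Gam x (bilin Gam y z) k - bilin Gam y (bilin Gam x z) k
  + bilin Gam (fun i => w i x y) z k.
Proof.
move=> sA sB sC x y z.
rewrite /curvature coframe_B; [|by apply: tangentB;
  exact: tangent_comb|exact: tangent_comb].
rewrite coframe_B; try exact: tangent_comb.
rewrite !frame_conn_comp.
have sc D i q : smooth_vf D -> smooth_at q (fun r => th i r (D r)).
  by move=> sD; exact: (comp_smooth i sD q).
have E (D D' : vfield M) : smooth_vf D -> smooth_vf D' ->
  D p (fun q => th k q (frame_conn Gam D' C q)) =
  D p (vf_app D' (fun q => th k q (C q))) +
  (bilin Gam (fun i => D p (fun q => th i q (D' q))) z k +
   bilin Gam (coframe_comps p (D' p)) (fun i => D p (fun q => th i q (C q))) k).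
  move=> sD sD'; have tD := sD.1 p.
  rewrite (_ : (fun q => th k q _) = fun q => vf_app D' (fun q => th k q (C q)) q +
     bilin Gam (coframe_comps q (D' q)) (coframe_comps q (C q)) k); last first.
    by apply/funext => q; rewrite frame_conn_comp.
  rewrite (tangent_add tD); last 2 first.
  - exact: (sD'.2 p _ (sc C k p sC)).
  - by apply: (@bilin_smooth Gam (fun q => coframe_comps q (D' q))
    (fun q => coframe_comps q (C q))) => i; exact: sc.
  congr (_ + _).
  rewrite (@bilin_derive Gam (fun q => coframe_comps q (D' q))
    (fun q => coframe_comps q (C q))
    k p (D p) tD) => [//|i|i]; exact: sc.
rewrite (E A B sA sB) (E B A sB sA) (bracketE A B (sc C k p sC)).
have F (D D' : vfield M) : smooth_vf D -> smooth_vf D' ->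
  bilin Gam (coframe_comps p (D p)) (coframe_comps p (frame_conn Gam D' C p)) k =
  bilin Gam (coframe_comps p (D p)) (fun i => D' p (fun q => th i q (C q))) k +
  bilin Gam (coframe_comps p (D p)) (bilin Gam (coframe_comps p (D' p)) z) k.
  move=> sD sD'; rewrite (_ : coframe_comps p (frame_conn _ _ _ _) = fun i =>
    1 * D' p (fun q => th i q (C q)) + bilin Gam (coframe_comps p (D' p)) z i).
    by rewrite bilin_linearr mul1r.
  by apply/funext => i; rewrite /coframe_comps frame_conn_comp mul1r.
rewrite (F A B sA sB) (F B A sB sA).
rewrite (_ : coframe_comps p (bracket A B p) = fun i =>
  (-1) * w i x y + ((-1) * B p (fun q => th i q (A q)) + A p (fun q => th i q (B q)))).
  rewrite !bilin_linearl /x /y /z; ring.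
apply/funext => i; rewrite /coframe_comps (bracket_comp p (dth i) sA sB) /x /y; ring.
Qed.

End Structure.

End Frame.

(** * The structure of the group in coordinates *)

Notation i4 k := (@Ordinal 4 k.-1 isT) (only parsing).

Lemma ord3P (P : 'I_3 -> Prop) : P (i3 1) -> P (i3 2) -> P (i3 3) -> forall s, P s.
Proof.
by move=> P1 P2 P3 [[|[|[|//]]] i]; rewrite (bool_irrelevance i isT).
Qed.

Lemma ord4P (P : 'I_4 -> Prop) : P (i4 1) -> P (i4 2) -> P (i4 3) -> P (i4 4) ->
  forall s, P s.
Proof.
by move=> P1 P2 P3 P4 [[|[|[|[|//]]]] i]; rewrite (bool_irrelevance i isT).
Qed.

Lemma ord7P (P : 'I_7 -> Prop) : P (i7 1) -> P (i7 2) -> P (i7 3) -> P (i7 4) ->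
  P (i7 5) -> P (i7 6) -> P (i7 7) -> forall s, P s.
Proof.
move=> P1 P2 P3 P4 P5 P6 P7 [[|[|[|[|[|[|[|//]]]]]]] i];
  by rewrite (bool_irrelevance i isT).
Qed.

Section ExplicitSums.
Context (V : nmodType).

Lemma sum3 (F : 'I_3 -> V) : \sum_(i < 3) F i = F (i3 1) + F (i3 2) + F (i3 3).
Proof.
rewrite !big_ord_recl big_ord0 addr0 !addrA.
by do 2?[congr (_ + _)]; congr F; exact: val_inj.
Qed.

Lemma sum4 (F : 'I_4 -> V) :
  \sum_(i < 4) F i = F (i4 1) + F (i4 2) + F (i4 3) + F (i4 4).
Proof.
rewrite !big_ord_recl big_ord0 addr0 !addrA.
by do 3?[congr (_ + _)]; congr F; exact: val_inj.
Qed.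

Lemma sum7 (F : 'I_7 -> V) :
  \sum_(i < 7) F i = F (i7 1) + F (i7 2) + F (i7 3) + F (i7 4) + F (i7 5)
                     + F (i7 6) + F (i7 7).
Proof.
rewrite !big_ord_recl big_ord0 addr0 !addrA.
by do 6?[congr (_ + _)]; congr F; exact: val_inj.
Qed.

End ExplicitSums.

Lemma rshift4E : (rshift 4 (i3 1) = i7 5 :> 'I_(4 + 3)) *
  (rshift 4 (i3 2) = i7 6 :> 'I_(4 + 3)) * (rshift 4 (i3 3) = i7 7 :> 'I_(4 + 3)).
Proof. by do !split; exact: val_inj. Qed.

Lemma lshift3E : (lshift 3 (i4 1) = i7 1 :> 'I_(4 + 3)) *
  (lshift 3 (i4 2) = i7 2 :> 'I_(4 + 3)) * (lshift 3 (i4 3) = i7 3 :> 'I_(4 + 3)) *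
  (lshift 3 (i4 4) = i7 4 :> 'I_(4 + 3)).
Proof. by do !split; exact: val_inj. Qed.

Section Model.
Context (R : realType).
Implicit Types (x y z : 'I_7 -> R).

Local Notation wd x y i j := (x (i7 i) * y (i7 j) - x (i7 j) * y (i7 i)).

Definition om_form (s : 'I_3) x y : R :=
  match val s with
  | 0 => wd x y 1 2 + wd x y 3 4
  | 1 => wd x y 1 3 + wd x y 4 2
  | _ => wd x y 1 4 + wd x y 2 3
  end.

Definition L2_form (k : 'I_7) x y : R :=
  match val k with
  | 0 => 0
  | 1 => - wd x y 1 2 + wd x y 3 4
  | 2 => - 2^-1 * wd x y 1 3
  | 3 => - 2^-1 * wd x y 1 4
  | 4 => 2 * wd x y 1 2 + 2 * wd x y 3 4 + wd x y 3 7 - wd x y 4 6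
         + 4^-1 * wd x y 6 7
  | 5 => 2 * wd x y 1 3 - 2 * wd x y 2 4 - 2^-1 * wd x y 2 7 + wd x y 4 5
         - 4^-1 * wd x y 5 7
  | _ => 2 * wd x y 1 4 + 2 * wd x y 2 3 + 2^-1 * wd x y 2 6 - wd x y 3 5
         + 4^-1 * wd x y 5 6
  end.

(** The components of I_s x, that is of the omega_s-dual of x. *)
Definition qc_endo (s : 'I_3) x (k : 'I_7) : R :=
  match val s, val k with
  | 0, 0 => - x (i7 2) | 0, 1 => x (i7 1) | 0, 2 => - x (i7 4) | 0, 3 => x (i7 3)
  | 1, 0 => - x (i7 3) | 1, 1 => x (i7 4) | 1, 2 => x (i7 1) | 1, 3 => - x (i7 2)
  | 2, 0 => - x (i7 4) | 2, 1 => - x (i7 3) | 2, 2 => x (i7 2) | 2, 3 => x (i7 1)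
  | _, _ => 0
  end.

(** On H the Levi-Civita coefficients of the horizontal structure constants; on V
    those induced by the identification with Q. The frame is parallel along e_1
    and along the Reeb fields. *)
Definition L2_christoffel (i j k : 'I_7) : R :=
  match val i, val j, val k with
  | 1, 0, 1 => -1      | 1, 1, 0 => 1       | 1, 2, 3 => 2^-1
  | 1, 3, 2 => - 2^-1  | 1, 5, 6 => - 2^-1  | 1, 6, 5 => 2^-1
  | 2, 0, 2 => - 2^-1  | 2, 1, 3 => 2^-1    | 2, 2, 0 => 2^-1
  | 2, 3, 1 => - 2^-1  | 2, 4, 6 => 1       | 2, 6, 4 => -1
  | 3, 0, 3 => - 2^-1  | 3, 1, 2 => - 2^-1  | 3, 2, 1 => 2^-1
  | 3, 3, 0 => 2^-1    | 3, 4, 5 => -1      | 3, 5, 4 => 1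
  | _, _, _ => 0
  end.

Definition L2_conn x y (k : 'I_7) : R :=
  match val k with
  | 0 => x (i7 2) * y (i7 2) + 2^-1 * x (i7 3) * y (i7 3) + 2^-1 * x (i7 4) * y (i7 4)
  | 1 => - x (i7 2) * y (i7 1) - 2^-1 * x (i7 3) * y (i7 4) + 2^-1 * x (i7 4) * y (i7 3)
  | 2 => - 2^-1 * x (i7 2) * y (i7 4) - 2^-1 * x (i7 3) * y (i7 1)
         - 2^-1 * x (i7 4) * y (i7 2)
  | 3 => 2^-1 * x (i7 2) * y (i7 3) + 2^-1 * x (i7 3) * y (i7 2)
         - 2^-1 * x (i7 4) * y (i7 1)
  | 4 => - x (i7 3) * y (i7 7) + x (i7 4) * y (i7 6)
  | 5 => 2^-1 * x (i7 2) * y (i7 7) - x (i7 4) * y (i7 5)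
  | _ => - 2^-1 * x (i7 2) * y (i7 6) + x (i7 3) * y (i7 5)
  end.

(** Linearity in x, in the form in which smoothness and derivatives pass
    through. *)
Lemma qc_endo_sum s x k :
  qc_endo s x k = \sum_(i < 7) qc_endo s (fun j => (j == i)%:R) k * x i.
Proof.
by rewrite sum7 /qc_endo; elim/ord3P: s; elim/ord7P: k => /=; ring.
Qed.

Lemma L2_connE x y k : bilin L2_christoffel x y k = L2_conn x y k.
Proof. by elim/ord7P: k; rewrite /bilin !sum7 /L2_christoffel /L2_conn /=; ring. Qed.

End Model.

Section L2.
Context (R : realType) (G : lieGroup R 7).
Context (th : 'I_7 -> oneform G) (e : 'I_7 -> vfield G).
Hypothesis coframe : is_coframe th e.
Hypothesis th_L2 : L2_equations th.
Implicit Types (p : G) (u v : tvec G) (X Y A B : vfield G).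

Local Notation q := (qc_of_coframe th e).
Local Notation comps := (coframe_comps th).

Lemma L2_differential k :
  has_differential (th k) (fun p u v => L2_form k (comps p u) (comps p v)).
Proof.
have [h1 [h2 [h3 [h4 [h5 [h6 h7]]]]]] := th_L2.
elim/ord7P: k => A B sA sB p.
- by rewrite h1.
- rewrite h2// /L2_form/= /wedge/comps !fctE; ring.
- rewrite h3// /L2_form/= /wedge/comps !fctE; ring.
- rewrite h4// /L2_form/= /wedge/comps !fctE; ring.
- rewrite h5// /L2_form/= /wedge/comps !fctE; ring.
- rewrite h6// /L2_form/= /wedge/comps !fctE; ring.
- rewrite h7// /L2_form/= /wedge/comps !fctE; ring.
Qed.

Lemma omega_ofE s p u v : omega_of th s p u v = om_form s (comps p u) (comps p v).
Proof.
elim/ord3P: s; rewrite /omega_of /om_form /= !fctE /wedge /comps; ring.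
Qed.

Lemma qc_I_comps s p u : comps p (qc_I q s p u) = qc_endo s (comps p u).
Proof.
apply/funext => k; rewrite /qc_I /= /Defs.hframe_of {1}/coframe_comps.
rewrite (_ : \sum_(a < 4) _ = \sum_(k < 7) qc_endo s (comps p u) k *: e k p).
  exact: (coframe_comb coframe).
rewrite sum4 sum7 !omega_ofE !lshift3E.
rewrite /om_form /qc_endo /coframe_comps.
elim/ord3P: s => /=; rewrite !(coframe_frame coframe) /= !scale0r !addr0;
  congr (_ *: _ + _ *: _ + _ *: _ + _ *: _); ring.
Qed.

Lemma eta_ofE : (eta_of th (i3 1) = th (i7 5)) * (eta_of th (i3 2) = th (i7 6)) *
  (eta_of th (i3 3) = th (i7 7)).
Proof. by rewrite /eta_of !rshift4E. Qed.

Lemma xi_ofE : (xi_of e (i3 1) = e (i7 5)) * (xi_of e (i3 2) = e (i7 6)) *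
  (xi_of e (i3 3) = e (i7 7)).
Proof. by rewrite /xi_of !rshift4E. Qed.

Lemma hor_comps p v : hor q p v ->
  [/\ comps p v (i7 5) = 0, comps p v (i7 6) = 0 & comps p v (i7 7) = 0].
Proof.
move=> [_ h]; have := h (i3 1); have := h (i3 2); have := h (i3 3).
by rewrite /qc_eta /= !eta_ofE.
Qed.

Lemma hor_of_comps p v : tangent p v ->
  comps p v (i7 5) = 0 -> comps p v (i7 6) = 0 -> comps p v (i7 7) = 0 ->
  hor q p v.
Proof.
move=> tv h5 h6 h7; split=> //.
by elim/ord3P; rewrite /= eta_ofE; [exact: h5|exact: h6|exact: h7]. Qed.

Lemma qc_I_tangent s p u : tangent p (qc_I q s p u).
Proof.
by apply: tangent_sum => a _; apply: tangentZ; exact: (frame_tangent coframe).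
Qed.

Lemma qc_I_hor s p u : hor q p (qc_I q s p u).
Proof.
by apply: hor_of_comps; [exact: qc_I_tangent|..]; rewrite qc_I_comps /qc_endo;
  elim/ord3P: s.
Qed.

Lemma qc_gE p u v : qc_g q p u v = \sum_(i < 7) comps p u i * comps p v i.
Proof. by []. Qed.

Lemma comps_ext p u v : tangent p u -> tangent p v -> comps p u = comps p v -> u = v.
Proof. by move=> tu tv uv; apply: (tangent_ext coframe tu tv) => i;
  exact: (congr1 (@^~ i) uv). Qed.

Lemma compsZD p (a : R) u v : tangent p u -> tangent p v ->
  comps p (a *: u + v) = fun i => a * comps p u i + comps p v i.
Proof. by move=> tu tv; apply/funext => i;
  exact: (coframe_linear coframe _ _ tu tv). Qed.

Lemma compsN p u : tangent p u -> comps p (- u) = fun i => - comps p u i.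
Proof. by move=> tu; apply/funext => i; exact: (coframe_N coframe _ tu). Qed.

Lemma smooth_fun_qc_endo s X k : smooth_vf X ->
  smooth_fun (fun p => qc_endo s (comps p (X p)) k).
Proof.
move=> sX p; have sx i := comp_smooth coframe i sX p.
apply: (@smooth_at_eq _ _ _ _ (fun r =>
    \sum_(i < 7) qc_endo s (fun j => (j == i)%:R) k * comps r (X r) i)).
  apply: smooth_at_sum => i _; exact: smooth_atM (smooth_at_cst _ _) (sx i).
by apply: nearW => r; rewrite -qc_endo_sum.
Qed.

Lemma qc_I_fieldE s X : I_field q s X =
  fun p => \sum_(k < 7) qc_endo s (comps p (X p)) k *: e k p.
Proof.
apply/funext => p; rewrite -qc_I_comps;
  exact: (frame_expand coframe (qc_I_tangent _ _ _)).
Qed.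

Lemma I_field_smooth s X : smooth_vf X -> smooth_vf (I_field q s X).
Proof.
by move=> sX; rewrite qc_I_fieldE; apply: (comb_smooth coframe) => k;
  exact: smooth_fun_qc_endo.
Qed.

(** Each axiom is tensorial, hence an identity between polynomials in components;
    the contact and Reeb conditions are read off the structure equations. *)
Theorem L2_is_qc : is_qc q.
Proof.
have sth i : smooth_form (th i) by case: coframe.
split.
- by elim/ord3P; rewrite /= eta_ofE.
- by elim/ord3P; rewrite /= xi_ofE; exact: frame_smooth coframe _.
- by move=> p u v _ _; rewrite !qc_gE; apply: eq_bigr => i _; rewrite mulrC.
- move=> p a u v w tu tv tw; rewrite !qc_gE compsZD// !sum7; ring.
- move=> p v tv v0; rewrite qc_gE lt0r; apply/andP; split; last first.
    by apply: sumr_ge0 => i _; exact: sqr_ge0.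
  apply/eqP => h; apply: v0; rewrite (frame_expand coframe tv) big1// => i _.
  have /(_ i isT)/eqP := psumr_eq0P (fun j _ => sqr_ge0 (comps p v j)) h.
  by rewrite expf_eq0 => /eqP; rewrite /coframe_comps => ->; rewrite scale0r.
- move=> X Y sX sY p; apply: smooth_at_sum => i _.
  exact: smooth_atM (comp_smooth coframe i sX p) (comp_smooth coframe i sY p).
- move=> p v s /hor_comps[h5 h6 h7]; rewrite qc_gE.
  by elim/ord3P: s; rewrite /= xi_ofE (comps_frame coframe) sum7 h5 h6 h7 /= ; ring.
- move=> p s k; rewrite qc_gE.
  by elim/ord3P: s; elim/ord3P: k;
    rewrite /= !xi_ofE !(comps_frame coframe) sum7 /=; ring.
- move=> s p; split=> [v _|a u v hu hv]; first exact: qc_I_hor.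
  apply: comps_ext; [exact: qc_I_tangent|apply: tangentZD; exact: qc_I_tangent|].
  rewrite compsZD; try exact: qc_I_tangent.
  rewrite !qc_I_comps compsZD; [|exact: hu.1|exact: hv.1].
  by apply/funext; rewrite /qc_endo; elim/ord7P; elim/ord3P: s => /=; ring.
- by move=> s X [sX _]; exact: I_field_smooth.
- move=> s p v hv; have [h5 h6 h7] := hor_comps hv.
  apply: comps_ext; [exact: qc_I_tangent|exact: tangentN hv.1|].
  rewrite !qc_I_comps compsN; last exact: hv.1.
  by apply/funext; rewrite /qc_endo; elim/ord7P; elim/ord3P: s => /=;
    rewrite ?h5 ?h6 ?h7; ring.
- move=> p v hv; apply: comps_ext; try exact: qc_I_tangent.
  by rewrite !qc_I_comps; apply/funext; rewrite /qc_endo; elim/ord7P => /=; ring.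
- move=> p v hv; apply: comps_ext;
  [exact: qc_I_tangent|apply: tangentN; exact: qc_I_tangent|].
  rewrite compsN; last exact: qc_I_tangent.
  by rewrite !qc_I_comps; apply/funext; rewrite /qc_endo; elim/ord7P => /=; ring.
- move=> p v hv; have [h5 h6 h7] := hor_comps hv.
  apply: comps_ext; [exact: qc_I_tangent|exact: tangentN hv.1|].
  rewrite !qc_I_comps compsN; last exact: hv.1.
  by apply/funext; rewrite /qc_endo; elim/ord7P => /=; rewrite ?h5 ?h6 ?h7; ring.
- move=> s p u v hu hv; have [h5 h6 h7] := hor_comps hu.
  rewrite !qc_gE !qc_I_comps !sum7 /qc_endo.
  by elim/ord3P: s => /=; rewrite h5 h6 h7; ring.
- move=> s X Y [sX hX] [sY hY] p.
  have [h5 h6 h7] := hor_comps (hX p); have [k5 k6 k7] := hor_comps (hY p).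
  rewrite qc_gE qc_I_comps sum7 /qc_endo.
  elim/ord3P: s => /=; rewrite eta_ofE (L2_differential _ sX sY) /L2_form /= ?h5 ?h6
    ?h7 ?k5 ?k6 ?k7; ring.
- move=> s k p; elim/ord3P: s; elim/ord3P: k;
  by rewrite /= eta_ofE xi_ofE (coframe_frame coframe).
- move=> s X [sX hX] p; have [h5 h6 h7] := hor_comps (hX p).
  have se i : smooth_vf (e i) := frame_smooth coframe i.
  elim/ord3P: s; rewrite /= eta_ofE xi_ofE (L2_differential _ (se _) sX) /L2_form
    (comps_frame coframe) /= ?h5 ?h6 ?h7; ring.
- move=> s k X [sX hX] p; have [h5 h6 h7] := hor_comps (hX p).
  have se i : smooth_vf (e i) := frame_smooth coframe i.
  elim/ord3P: s; elim/ord3P: k;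
    rewrite /= !eta_ofE !xi_ofE !(L2_differential _ (se _) sX) /L2_form
    !(comps_frame coframe) /= ?h5 ?h6 ?h7; ring.
Qed.

End L2.

(** * The Biquard connection *)

Section FrameConnections.
Context (R : realType) (n : nat) (M : manifold R n).
Context (th : 'I_n -> oneform M) (e : 'I_n -> vfield M).
Hypothesis coframe : is_coframe th e.
Implicit Types (A B : vfield M).

Let comb (r : seq 'I_n) (f : 'I_n -> M -> R) : vfield M :=
  fun p => \sum_(i <- r) f i p *: e i p.

Let comb0 f : comb [::] f = fun=> 0.
Proof. by apply/funext => p; rewrite /comb big_nil. Qed.

Let comb_cons i r f :
  comb (i :: r) f = vf_add (vf_scale (f i) (e i)) (comb r f).
Proof. by apply/funext => p; rewrite /comb big_cons. Qed.

Let smooth_comb r f : (forall i, smooth_fun (f i)) -> smooth_vf (comb r f).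
Proof. by move=> sf; exact: smooth_vf_comb sf (frame_smooth coframe). Qed.

Let smooth_vf0 : smooth_vf (fun=> 0 : tvec M).
Proof. by rewrite -(comb0 (fun _ _ => 0)); apply: smooth_comb => i p;
  exact: smooth_at_cst. Qed.

Let expandE A : smooth_vf A -> A = comb (index_enum 'I_n) (fun i p => th i p (A p)).
Proof. by move=> sA; apply/funext => p; exact: frame_expand coframe _ _ (sA.1 p). Qed.

(** Linearity over functions in the first argument and the Leibniz rule in the
    second reduce to frame vectors, every smooth field being a combination of
    them with smooth coefficients. *)
Lemma connection_frame_unique N N' : is_connection N -> is_connection N' ->
  (forall i j, N (e i) (e j) = N' (e i) (e j)) ->
  forall A B, smooth_vf A -> smooth_vf B -> N A B = N' A B.
Proof.
move=> cN cN' NN'.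
have se := frame_smooth coframe.
have zero_l N0 B : is_connection N0 -> smooth_vf B -> N0 (fun=> 0) B = fun=> 0.
  move=> c0 sB.
  have := conn_left c0 (fun p => smooth_at_cst p 1) smooth_vf0 smooth_vf0 sB.
  rewrite (_ : vf_add _ (fun=> 0) = fun=> 0); last first.
    by apply/funext => p; rewrite /vf_add/vf_scale scaler0 addr0.
  move=> h; apply/funext => p; have := congr1 (@^~ p) h.
  rewrite /vf_add/vf_scale scale1r => {}h.
  by apply: (addrI (N0 (fun=> 0) B p)); rewrite addr0 -h.
have zero_r N0 A : is_connection N0 -> smooth_vf A -> N0 A (fun=> 0) = fun=> 0.
  move=> c0 sA.
  have := conn_leibniz c0 (fun p => smooth_at_cst p 0) sA smooth_vf0.
  rewrite (_ : vf_scale _ _ = fun=> 0); last first.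
    by apply/funext => p; rewrite /vf_scale scaler0.
  move=> ->; apply/funext => p.
  by rewrite /vf_add/vf_scale scaler0 scale0r addr0.
have right i B : smooth_vf B -> N (e i) B = N' (e i) B.
  move=> sB; rewrite (expandE sB).
  elim: (index_enum _) => [|j r IH]; first by rewrite comb0 (zero_r _ _ cN (se i))
    (zero_r _ _ cN' (se i)).
  have sBj := comp_smooth coframe j sB.
  have sr : smooth_vf (comb r (fun i p => th i p (B p))).
    by apply: smooth_comb => k; exact: comp_smooth coframe k _ sB.
  have sj := smooth_vf_scale sBj (se j).
  rewrite comb_cons (conn_add cN (se i) sj sr) (conn_add cN' (se i) sj sr) IH.
  by rewrite (conn_leibniz cN sBj (se i) (se j))
    (conn_leibniz cN' sBj (se i) (se j)) NN'.
move=> A B sA sB; rewrite (expandE sA).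
elim: (index_enum _) => [|j r IH]; first by rewrite comb0 (zero_l _ _ cN sB)
  (zero_l _ _ cN' sB).
have sAj := comp_smooth coframe j sA.
have sr : smooth_vf (comb r (fun i p => th i p (A p))).
  by apply: smooth_comb => k; exact: comp_smooth coframe k _ sA.
rewrite comb_cons (conn_left cN sAj (se j) sr sB) (conn_left cN' sAj (se j) sr sB).
by rewrite IH right.
Qed.

End FrameConnections.

(** The uniqueness of the Levi-Civita connection: the difference of two metric
    connections with equal torsion is such a D. *)
Lemma skew_symmetric0 (R : realType) (I : Type) (D : I -> I -> I -> R) :
  (forall a b c, D a b c = - D a c b) -> (forall a b c, D a b c = D b a c) ->
  forall a b c, D a b c = 0.
Proof.
move=> skew sym a b c.
have : D a b c = - D a b c by rewrite {1}sym skew sym skew sym {1}skew opprK.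
lra.
Qed.

Section BiquardModel.
Context (R : realType).
Implicit Types (x y z u v : 'I_7 -> R).

(** Right multiplications by the imaginary quaternions, the I_s being left
    multiplications; they come from e12 - e34, e13 - e42, e14 - e23. *)
Definition asd_endo (s : 'I_3) x (k : 'I_7) : R :=
  match val s, val k with
  | 0, 0 => - x (i7 2) | 0, 1 => x (i7 1) | 0, 2 => x (i7 4) | 0, 3 => - x (i7 3)
  | 1, 0 => - x (i7 3) | 1, 1 => - x (i7 4) | 1, 2 => x (i7 1) | 1, 3 => x (i7 2)
  | 2, 0 => - x (i7 4) | 2, 1 => x (i7 3) | 2, 2 => - x (i7 2) | 2, 3 => x (i7 1)
  | _, _ => 0
  end.

Definition vert (a : 'I_3 -> R) (k : 'I_7) : R :=
  match val k with 4 => a (i3 1) | 5 => a (i3 2) | 6 => a (i3 3) | _ => 0 end.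

(** The commutator of the connection form on H with I_s is the combination of
    the I_t given by the connection form on V. The variables a, y stand for the
    values of functions with derivatives da, dy. *)
Lemma L2_conn_Q (a da : 'I_3 -> R) x y dy k :
  \sum_(s < 3) (da s * qc_endo s y k + a s * qc_endo s dy k)
  + L2_conn x (fun i => \sum_(s < 3) a s * qc_endo s y i) k
  - \sum_(s < 3) a s * qc_endo s (fun i => dy i + L2_conn x y i) k =
  \sum_(s < 3) (da s + L2_conn x (vert a) (rshift 4 s : 'I_(4 + 3))) * qc_endo s y k.
Proof.
rewrite !sum3 !rshift4E /qc_endo /L2_conn /vert !sum3.
by elim/ord7P: k => /=; rewrite ?sum3 /=; field.
Qed.

End BiquardModel.

Section Biquard.
Context (R : realType) (G : lieGroup R 7).
Context (th : 'I_7 -> oneform G) (e : 'I_7 -> vfield G).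
Hypothesis coframe : is_coframe th e.
Hypothesis th_L2 : L2_equations th.
Implicit Types (p : G) (u v : tvec G) (X Y A B U : vfield G).

Local Notation q := (qc_of_coframe th e).
Local Notation comps := (coframe_comps th).
Local Notation nabla := (frame_conn th e (@L2_christoffel R)).

Let se i : smooth_vf (e i) := frame_smooth coframe i.

Lemma nabla_comps A B p k : comps p (nabla A B p) k =
  A p (fun r => comps r (B r) k) + L2_conn (comps p (A p)) (comps p (B p)) k.
Proof. by rewrite -L2_connE; exact: frame_conn_comp. Qed.

Lemma nabla_tangent A B p : tangent p (nabla A B p).
Proof. exact: (tangent_comb coframe). Qed.

Lemma ver_comps p v : ver q p v ->
  [/\ tangent p v, comps p v (i7 1) = 0, comps p v (i7 2) = 0,
      comps p v (i7 3) = 0 & comps p v (i7 4) = 0].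
Proof.
move=> [c ->]; rewrite sum3 /= !xi_ofE.
have E : \sum_(k < 7) vert c k *: e k p =
    c (i3 1) *: e (i7 5) p + c (i3 2) *: e (i7 6) p + c (i3 3) *: e (i7 7) p.
  by rewrite sum7 /vert /= !scale0r !add0r.
rewrite -E; split; first exact: (tangent_comb coframe).
all: by rewrite /coframe_comps (coframe_comb coframe).
Qed.

Lemma ver_of_comps p v : tangent p v -> comps p v (i7 1) = 0 ->
  comps p v (i7 2) = 0 -> comps p v (i7 3) = 0 -> comps p v (i7 4) = 0 -> ver q p v.
Proof.
move=> tv h1 h2 h3 h4; exists (fun s => comps p v (rshift 4 s : 'I_(4 + 3))).
rewrite {1}(frame_expand coframe tv) sum7 sum3 /= !xi_ofE !rshift4E.
by rewrite /coframe_comps in h1 h2 h3 h4 *; rewrite h1 h2 h3 h4 !scale0r !add0r.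
Qed.

Lemma nabla_hor A X : smooth_vf A -> hor_field q X -> hor_field q (nabla A X).
Proof.
move=> sA [sX hX]; split; first exact: (frame_conn_smooth coframe).
have E k p : (forall r, comps r (X r) k = 0) -> A p (fun r => comps r (X r) k) = 0.
  by move=> h; rewrite (_ : (fun r => _) = fun=> 0);
    [exact: tangent_cst (sA.1 p) _|apply/funext].
have h5 r : comps r (X r) (i7 5) = 0 by have [] := hor_comps (hX r).
have h6 r : comps r (X r) (i7 6) = 0 by have [] := hor_comps (hX r).
have h7 r : comps r (X r) (i7 7) = 0 by have [] := hor_comps (hX r).
move=> p; apply: hor_of_comps; first exact: nabla_tangent.
all: rewrite nabla_comps E// /L2_conn /= ?h5 ?h6 ?h7; ring.
Qed.

Lemma nabla_ver A X : smooth_vf A -> ver_field q X -> ver_field q (nabla A X).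
Proof.
move=> sA [sX hX]; split; first exact: (frame_conn_smooth coframe).
have E k p : (forall r, comps r (X r) k = 0) -> A p (fun r => comps r (X r) k) = 0.
  by move=> h; rewrite (_ : (fun r => _) = fun=> 0);
    [exact: tangent_cst (sA.1 p) _|apply/funext].
have h1 r : comps r (X r) (i7 1) = 0 by have [] := ver_comps (hX r).
have h2 r : comps r (X r) (i7 2) = 0 by have [] := ver_comps (hX r).
have h3 r : comps r (X r) (i7 3) = 0 by have [] := ver_comps (hX r).
have h4 r : comps r (X r) (i7 4) = 0 by have [] := ver_comps (hX r).
move=> p; apply: ver_of_comps; first exact: nabla_tangent.
all: rewrite nabla_comps E// /L2_conn /= ?h1 ?h2 ?h3 ?h4; ring.
Qed.

Lemma nabla_metric A B C p : smooth_vf A -> smooth_vf B -> smooth_vf C ->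
  A p (fun x => qc_g q x (B x) (C x)) =
  qc_g q p (nabla A B p) (C p) + qc_g q p (B p) (nabla A C p).
Proof.
move=> sA sB sC.
have sb i := comp_smooth coframe i sB p.
have sc i := comp_smooth coframe i sC p.
rewrite (tangent_bigsum (sA.1 p)) => [|i]; last exact: smooth_atM (sb i) (sc i).
rewrite !qc_gE !sum7 !nabla_comps.
rewrite !(tangent_leibniz (sA.1 p) (sb _) (sc _)) /L2_conn /coframe_comps /=; ring.
Qed.

Lemma Q_section_comps (a : 'I_3 -> G -> R) p v :
  comps p (Q_section q a p v) = fun k => \sum_(s < 3) a s p * qc_endo s (comps p v) k.
Proof.
apply/funext => k; rewrite /coframe_comps (coframe_sum coframe); last first.
  by move=> s; apply: tangentZ; exact: qc_I_tangent.
apply: eq_bigr => s _; rewrite (coframe_Z coframe); last exact: qc_I_tangent.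
by congr (_ * _); rewrite -[LHS]/(comps p (qc_I q s p v) k) qc_I_comps.
Qed.

Lemma Q_section_tangent (a : 'I_3 -> G -> R) p v : tangent p (Q_section q a p v).
Proof. by apply: tangent_sum => s _; apply: tangentZ; exact: qc_I_tangent. Qed.

Lemma derive_qc_endo v p s k X : tangent p v -> smooth_vf X ->
  v (fun r => qc_endo s (comps r (X r)) k) =
  qc_endo s (fun i => v (fun r => comps r (X r) i)) k.
Proof.
move=> tv sX; have sx i := comp_smooth coframe i sX p.
rewrite qc_endo_sum (_ : (fun r => _) =
    fun r => \sum_(i < 7) qc_endo s (fun j => (j == i)%:R) k * comps r (X r) i).
  rewrite (tangent_bigsum tv) => [|i]; last exact: smooth_atM (smooth_at_cst _ _)
    (sx i).
  by apply: eq_bigr => i _; rewrite (tangent_scale tv _ (sx i)).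
by apply/funext => r; rewrite -qc_endo_sum.
Qed.

(** Both the invariance of Q and the parallelism of phi: the coefficients of the
    derivative on Q are those of the derivative on V. *)
Lemma nabla_Q A (a : 'I_3 -> G -> R) X p : smooth_vf A ->
  (forall s, smooth_fun (a s)) -> hor_field q X ->
  nabla A (fun x => Q_section q a x (X x)) p - Q_section q a p (nabla A X p) =
  Q_section q (fun s r => A r (a s) +
    L2_conn (comps r (A r)) (vert (a^~ r)) (rshift 4 s : 'I_(4 + 3))) p (X p).
Proof.
move=> sA sa [sX hX]; have tA := sA.1 p.
apply: (comps_ext coframe).
- by apply: tangentB; [exact: nabla_tangent|exact: Q_section_tangent].
- exact: Q_section_tangent.
apply/funext => k; rewrite /coframe_comps (coframe_B coframe); last 2 first.
- exact: nabla_tangent.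
- exact: Q_section_tangent.
rewrite -![th k p _]/(comps p _ k) nabla_comps !Q_section_comps.
rewrite -(L2_conn_Q _ _ _ _ (fun i => A p (fun r => comps r (X r) i))).
congr (_ + _ - _).
- have sx s := smooth_fun_qc_endo coframe s k sX p.
  rewrite (_ : (fun r => _) = fun r => \sum_(s < 3) a s r * qc_endo s
    (comps r (X r)) k).
    rewrite (tangent_bigsum tA) => [|s]; last exact: smooth_atM (sa s p) (sx s).
    apply: eq_bigr => s _; rewrite (tangent_leibniz tA (sa s p) (sx s)).
    by rewrite (derive_qc_endo s k tA sX).
  by apply/funext => r; rewrite Q_section_comps.
- apply: eq_bigr => s _; congr (_ * qc_endo s _ k).
  by apply/funext => i; rewrite nabla_comps.
Qed.

(** On frame fields: the bracket of xi_s and e_a is minus the derivative of xi_s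
    along e_a, and the frame is parallel along xi_s. *)
Lemma nabla_torsion_ver U X p : ver_field q U -> hor_field q X ->
  torsion nabla U X p = 0.
Proof.
move=> [sU hU] [sX hX]; apply: (comps_ext coframe).
- exact: (torsion_tangent coframe).
- exact: tangent0.
have [_ u1 u2 u3 u4] := ver_comps (hU p).
have [x5 x6 x7] := hor_comps (hX p).
apply/funext => k; rewrite /coframe_comps
  (torsion_comp coframe (L2_differential th_L2) _ _ _ sU sX).
rewrite (coframe0 coframe) !L2_connE /L2_conn /L2_form.
elim/ord7P: k => /=; rewrite ?u1 ?u2 ?u3 ?u4 ?x5 ?x6 ?x7; ring.
Qed.

Lemma hor_field0 : hor_field q (fun=> 0 : tvec G).
Proof.
split=> [|p]; last first.
  by apply: hor_of_comps; [exact: tangent0|..]; exact: (coframe0 coframe).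
apply: (smooth_vf_comps coframe) => [p|i p]; first exact: tangent0.
rewrite (_ : (fun r => _) = fun=> 0); first exact: smooth_at_cst.
by apply/funext => r; exact: (coframe0 coframe).
Qed.

Theorem nabla_is_biquard : is_biquard q nabla.
Proof.
split.
- exact: frame_conn_is_connection.
- exact: nabla_hor.
- exact: nabla_ver.
- by move=> A B C sA sB sC p; exact: nabla_metric.
- move=> X Y [sX hX] [sY hY] p.
  have [x5 x6 x7] := hor_comps (hX p); have [y5 y6 y7] := hor_comps (hY p).
  have tb := bracket_tangent p sX sY.
  have tv : tangent p (\sum_(s < 3) qc_eta q s p (bracket X Y p) *: qc_xi q s p).
    by apply: tangent_sum => s _; apply: tangentZ; exact: (se _).1.
  apply: (comps_ext coframe); [exact: (torsion_tangent coframe)|exact: tangentN|].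
  apply/funext => k; rewrite /coframe_comps
    (torsion_comp coframe (L2_differential th_L2) _ _ _ sX sY).
  rewrite (coframe_N coframe _ tv) (coframe_sum coframe); last first.
    by move=> s; apply: tangentZ; exact: (se _).1.
  have eZ i (a : R) j : th i p (a *: e j p) = a * th i p (e j p).
    exact: (coframe_Z coframe i a (frame_tangent coframe j p)).
  rewrite sum3 /= !eta_ofE !xi_ofE !eZ.
  rewrite !(coframe_frame coframe) !(bracket_comp p (L2_differential th_L2 _) sX sY).
  have X0 k' : (forall r, comps r (X r) k' = 0) -> (fun r => th k' r (X r)) = fun=> 0.
    by move=> h; apply/funext.
  have Y0 k' : (forall r, comps r (Y r) k' = 0) -> (fun r => th k' r (Y r)) = fun=> 0.
    by move=> h; apply/funext.
  rewrite X0; last by move=> r; have [] := hor_comps (hX r).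
  rewrite X0; last by move=> r; have [] := hor_comps (hX r).
  rewrite X0; last by move=> r; have [] := hor_comps (hX r).
  rewrite Y0; last by move=> r; have [] := hor_comps (hY r).
  rewrite Y0; last by move=> r; have [] := hor_comps (hY r).
  rewrite Y0; last by move=> r; have [] := hor_comps (hY r).
  rewrite !(tangent_cst (sX.1 p)) !(tangent_cst (sY.1 p)) !L2_connE /L2_conn /L2_form.
  by elim/ord7P: k => /=; rewrite ?x5 ?x6 ?x7 ?y5 ?y6 ?y7; field.
- move=> A a sA sa; exists (fun s r => A r (a s) +
    L2_conn (comps r (A r)) (vert (a^~ r)) (rshift 4 s : 'I_(4 + 3))); split.
    move=> s p; apply: smooth_atD; first exact: sA.2 p _ (sa s p).
    rewrite (_ : (fun r => _) = fun r => bilin (@L2_christoffel R) (comps r (A r))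
      (vert (a^~ r)) (rshift 4 s : 'I_(4 + 3))).
      apply: (@bilin_smooth _ _ _ _ (fun r => comps r (A r))
        (fun r => vert (a^~ r))) => i.
        exact: comp_smooth coframe i _ sA p.
      by elim/ord7P: i; rewrite /vert /=; [exact: smooth_at_cst|exact: smooth_at_cst|
        exact: smooth_at_cst|exact: smooth_at_cst|exact: sa|exact: sa|exact: sa].
    by apply/funext => r; rewrite L2_connE.
  by move=> X hX p; exact: nabla_Q.
- move=> U X hU hX; rewrite (_ : torsion _ _ _ = fun=> 0); first exact: hor_field0.
  by apply/funext => p; exact: nabla_torsion_ver.
- move=> U p E B hU [hE _] _; apply: big1 => a _.
  rewrite nabla_torsion_ver// qc_gE big1// => i _.
  by rewrite /coframe_comps (coframe0 coframe) mul0r.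
- move=> A U X sA [sU hU] hX p.
  have sa (s : 'I_3) : smooth_fun (fun r => qc_eta q s r (U r))
    by exact: comp_smooth coframe _ _ sU.
  have := nabla_Q p sA sa hX.
  rewrite /phi /Q_section => ->; apply: eq_bigr => s _; congr (_ *: _).
  have [_ u1 u2 u3 u4] := ver_comps (hU p).
  elim/ord3P: s; rewrite /= !eta_ofE !rshift4E -[RHS]/(comps p _ _) nabla_comps;
    rewrite /L2_conn /vert /= !eta_ofE; congr (_ + _); rewrite /coframe_comps; ring.
Qed.

End Biquard.

Section BiquardUniqueness.
Context (R : realType) (G : lieGroup R 7).
Context (th : 'I_7 -> oneform G) (e : 'I_7 -> vfield G).
Hypothesis coframe : is_coframe th e.
Hypothesis th_L2 : L2_equations th.
Implicit Types (p : G) (u v : tvec G) (X Y A B U : vfield G).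

Local Notation q := (qc_of_coframe th e).
Local Notation comps := (coframe_comps th).
Local Notation nabla := (frame_conn th e (@L2_christoffel R)).
Local Notation hidx a := (lshift 3 a : 'I_(4 + 3)).
Local Notation vidx s := (rshift 4 s : 'I_(4 + 3)).

Let se i : smooth_vf (e i) := frame_smooth coframe i.

Lemma hframe_hor a : hor_field q (e (hidx a)).
Proof.
split=> // p; apply: hor_of_comps; first exact: (frame_tangent coframe).
all: by rewrite (comps_frame coframe); elim/ord4P: a; rewrite lshift3E.
Qed.

Lemma vframe_ver s : ver_field q (e (vidx s)).
Proof.
split=> // p; apply: (ver_of_comps coframe); first exact: (frame_tangent coframe).
all: by rewrite (comps_frame coframe); elim/ord3P: s; rewrite rshift4E.
Qed.

Lemma hframe_orthonormal p : orthonormal_at q p (hframe_of e).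
Proof.
split=> [a|a b]; first exact: hframe_hor.
rewrite qc_gE /hframe_of !(comps_frame coframe) sum7.
by elim/ord4P: a; elim/ord4P: b; rewrite !lshift3E /=; ring.
Qed.

Lemma qc_g_frame p u k : qc_g q p u (e k p) = comps p u k.
Proof.
by rewrite qc_gE (comps_frame coframe) sum7; elim/ord7P: k => /=; ring.
Qed.

Lemma qc_I_sp1sp1 s p : sp1sp1 q p (qc_I q s p).
Proof.
exists (fun t => (t == s)%:R), (fun=> 0); split.
- split=> [v _|a u v _ _]; last by rewrite scaler0 addr0.
  by apply: hor_of_comps; [exact: tangent0|..]; exact: (coframe0 coframe).
- move=> u v _ _; rewrite !qc_gE (_ : comps p 0 = fun=> 0); last first.
    by apply/funext => i; exact: (coframe0 coframe).
  by rewrite !sum7; ring.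
- move=> t v hv; apply: (comps_ext coframe); [exact: tangent0|exact: qc_I_tangent|].
  rewrite qc_I_comps//; apply/funext => k; rewrite /qc_endo.
  have z i : comps p 0 i = 0 by exact: (coframe0 coframe).
  by elim/ord3P: t; elim/ord7P: k => /=; rewrite !z ?oppr0.
- move=> v _; rewrite addr0 (bigD1 s)//= eqxx scale1r [X in _ + X]big1 ?addr0// =>
  t /negbTE ->.
  by rewrite scale0r.
Qed.

(** These are skew and commute with Q: left and right multiplications commute. *)
Lemma asd_sp1sp1 s p :
  sp1sp1 q p (fun v => \sum_(k < 7) asd_endo s (comps p v) k *: e k p).
Proof.
have cC v : comps p (\sum_(k < 7) asd_endo s (comps p v) k *: e k p) =
  asd_endo s (comps p v).
  by apply/funext => k; exact: (coframe_comb coframe).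
have tC v : tangent p (\sum_(k < 7) asd_endo s (comps p v) k *: e k p).
  exact: (tangent_comb coframe).
exists (fun=> 0), (fun v => \sum_(k < 7) asd_endo s (comps p v) k *: e k p); split.
- split=> [v _|a u v hu hv].
    by apply: hor_of_comps; [exact: tC|..]; rewrite cC; elim/ord3P: s {cC tC}.
  apply: (comps_ext coframe); [exact: tC|exact: tangentZD|].
  rewrite cC (compsZD coframe _ (tC _) (tC _)) !cC (compsZD coframe _ hu.1 hv.1).
  apply/funext => k; rewrite /asd_endo.
  by elim/ord3P: s {cC tC}; elim/ord7P: k => /=; ring.
- move=> u v _ _; rewrite !qc_gE !cC !sum7 /asd_endo.
  by elim/ord3P: s {cC tC} => /=; ring.
- move=> t v _; apply: (comps_ext coframe); [exact: tC|exact: qc_I_tangent|].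
  rewrite cC !qc_I_comps// cC; apply/funext => k; rewrite /asd_endo /qc_endo.
  by elim/ord3P: s {cC tC}; elim/ord3P: t; elim/ord7P: k => /=; ring.
- by move=> v _; rewrite [X in X + _]big1 ?add0r// => t _; rewrite scale0r.
Qed.

(** The difference D of two such connections is a tensor. It is skew since both
    are metric, and preserves the splitting. On H in horizontal directions it
    vanishes because the torsions agree. In a vertical direction it is an element
    of so(4) = sp(1) + sp(1) that is orthogonal to sp(1) + sp(1). On V it is then
    determined by phi. *)
Theorem nabla_unique N : is_biquard q N ->
  forall A B, smooth_vf A -> smooth_vf B -> N A B = nabla A B.
Proof.
move=> bN; have bq := nabla_is_biquard coframe th_L2.
apply: (connection_frame_unique coframe (bq_conn bN) (bq_conn bq)) => i j.
apply/funext => p.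
have tN A B : smooth_vf A -> smooth_vf B -> tangent p (N A B p).
  by move=> sA sB; exact: (conn_smooth (bq_conn bN) sA sB).1.
have tn A B : tangent p (nabla A B p) := nabla_tangent coframe A B p.
pose D i j k := comps p (N (e i) (e j) p) k - comps p (nabla (e i) (e j) p) k.
have skew i' j' k' : D i' j' k' = - D i' k' j'.
  have := bq_metric bN (se i') (se j') (se k') p.
  rewrite (bq_metric bq (se i') (se j') (se k') p).
  have gC v k : tangent p v -> qc_g q p (e k p) v = comps p v k.
    by move=> tv; rewrite -qc_g_frame !qc_gE; apply: eq_bigr => l _; rewrite mulrC.
  rewrite !qc_g_frame (gC _ _ (tN _ _ (se i') (se k'))) (gC _ _ (tn (e i') (e k'))) /D.
  lra.
have horN i' a s : comps p (N (e i') (e (hidx a)) p) (vidx s) = 0.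
  have [_ /(_ p)/hor_comps[h5 h6 h7]] := bq_hor bN (se i') (hframe_hor a).
  by elim/ord3P: s; rewrite rshift4E.
have horn i' a s : comps p (nabla (e i') (e (hidx a)) p) (vidx s) = 0.
  have [_ /(_ p)/hor_comps[h5 h6 h7]] := bq_hor bq (se i') (hframe_hor a).
  by elim/ord3P: s; rewrite rshift4E.
have DHV i' a s : D i' (hidx a) (vidx s) = 0 by rewrite /D horN horn subrr.
have DVH i' s a : D i' (vidx s) (hidx a) = 0 by rewrite skew DHV oppr0.
have sym a b k : D (hidx a) (hidx b) k = D (hidx b) (hidx a) k.
  have := bq_torsion_hor bN (hframe_hor a) (hframe_hor b) p.
  rewrite -(bq_torsion_hor bq (hframe_hor a) (hframe_hor b) p) /torsion.
  move/(congr1 (fun v => comps p (v + bracket (e (hidx a)) (e (hidx b)) p) k)).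
  rewrite !subrK /coframe_comps !(coframe_B coframe); try by [exact: tN|exact: tn].
  rewrite /D /coframe_comps; lra.
have DHHH a b c : D (hidx a) (hidx b) (hidx c) = 0.
  by apply: (skew_symmetric0 (D := fun a b c => D (hidx a) (hidx b) (hidx c))).
have perp s (B : tvec G -> tvec G) : sp1sp1 q p B ->
    \sum_(a < 4) \sum_(c < 4) D (vidx s) (hidx a) (hidx c) *
       comps p (B (e (hidx a) p)) (hidx c) = 0.
  move=> sB.
  rewrite -[RHS](bq_torsion_perp bN (vframe_ver s) (hframe_orthonormal p) sB).
  apply: eq_bigr => a _; rewrite qc_gE [RHS](@big_split_ord _ _ _ 4 3) /=.
  have [_ /(_ p) ht] := bq_torsion_ver bN (vframe_ver s) (hframe_hor a).
  rewrite [X in _ = _ + X]big1 => [|t _]; last first.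
    have [h5 h6 h7] := hor_comps ht.
    by elim/ord3P: t; rewrite rshift4E ?h5 ?h6 ?h7 mul0r.
  rewrite addr0; apply: eq_bigr => c _; congr (_ * _).
  have sU := se (vidx s); have sa := se (hidx a).
  have /eqP := nabla_torsion_ver coframe th_L2 p (vframe_ver s) (hframe_hor a).
  rewrite /torsion /hframe_of subr_eq0 => /eqP <-.
  have tNN := tangentB (tN _ _ sU sa) (tN _ _ sa sU).
  have tnn := tangentB (tn (e (vidx s)) (e (hidx a))) (tn (e (hidx a)) (e (vidx s))).
  rewrite /coframe_comps (coframe_B coframe _ tNN tnn).
  rewrite (coframe_B coframe _ (tN _ _ sU sa) (tN _ _ sa sU))
    (coframe_B coframe _ (tn _ _) (tn _ _)).
  have := DVH (hidx a) s c; rewrite /D /coframe_comps; lra.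
have DVHH s a c : D (vidx s) (hidx a) (hidx c) = 0.
  (* The six endomorphisms span so(4). *)
  have E1 := perp s _ (qc_I_sp1sp1 (i3 1) p).
  have E2 := perp s _ (qc_I_sp1sp1 (i3 2) p).
  have E3 := perp s _ (qc_I_sp1sp1 (i3 3) p).
  have F1 := perp s _ (asd_sp1sp1 (i3 1) p).
  have F2 := perp s _ (asd_sp1sp1 (i3 2) p).
  have F3 := perp s _ (asd_sp1sp1 (i3 3) p).
  have sk a' c' : D (vidx s) a' c' = - D (vidx s) c' a' by exact: skew.
  have cC s' v : comps p (\sum_(k < 7) asd_endo s' (comps p v) k *: e k p) =
    asd_endo s' (comps p v).
    by apply/funext => k; exact: (coframe_comb coframe).
  move: E1 E2 E3 F1 F2 F3; rewrite !sum4 !cC !qc_I_comps// !(comps_frame coframe)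
    !lshift3E.
  rewrite /qc_endo /asd_endo /=.
  have d11 := sk (i7 1) (i7 1); have d22 := sk (i7 2) (i7 2).
  have d33 := sk (i7 3) (i7 3); have d44 := sk (i7 4) (i7 4).
  rewrite (sk (i7 2) (i7 1)) (sk (i7 3) (i7 1)) (sk (i7 4) (i7 1)).
  rewrite (sk (i7 3) (i7 2)) (sk (i7 4) (i7 2)) (sk (i7 4) (i7 3)).
  have s21 := sk (i7 2) (i7 1); have s31 := sk (i7 3) (i7 1); have s41 :=
    sk (i7 4) (i7 1).
  have s32 := sk (i7 3) (i7 2); have s42 := sk (i7 4) (i7 2); have s43 :=
    sk (i7 4) (i7 3).
  by elim/ord4P: a; elim/ord4P: c; rewrite !lshift3E; lra.
have DH i' a k : D i' (hidx a) k = 0.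
  have [c ->|t ->] := split_ordP (k : 'I_(4 + 3)); last exact: DHV.
  by have [b ->|t ->] := split_ordP (i' : 'I_(4 + 3)); [exact: DHHH|exact: DVHH].
have Nh i' a : N (e i') (e (hidx a)) p = nabla (e i') (e (hidx a)) p.
  apply: (comps_ext coframe); [exact: tN|exact: tn|].
  by apply/funext => k; have := DH i' a k; rewrite /D; lra.
(* phi (xi_s) e_1 = e_(1+s), so the parallel identification V = Q fixes the
   connection on V. *)
have DVV i' s t : D i' (vidx s) (vidx t) = 0.
  have E (b : 'I_4) (v := fun x => phi q x (e (vidx s) x) (e (hidx (i4 1)) x)) :
      b = lift ord0 s -> v = e (hidx b).
    move=> ->; apply/funext => x; apply: (comps_ext coframe).
    - by apply: tangent_sum => r _; apply: tangentZ; exact: qc_I_tangent.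
    - exact: (frame_tangent coframe).
    have -> : v x = Q_section q (fun r _ => qc_eta q r x (e (vidx s) x)) x
                      (e (hidx (i4 1)) x) by [].
    rewrite (Q_section_comps coframe) !(comps_frame coframe); apply/funext => k;
      rewrite sum3 /= !eta_ofE /qc_endo {b}.
    by move: s @v; elim/ord3P => v; elim/ord7P: k;
      rewrite ?rshift4E /= !(coframe_frame coframe) /=; ring.
  have hh := hframe_hor (i4 1).
  have P1 := bq_phi bN (se i') (vframe_ver s) hh p.
  have P0 := bq_phi bq (se i') (vframe_ver s) hh p.
  rewrite (E _ erefl) !Nh in P1; rewrite (E _ erefl) P1 in P0.
  move: P0 => /(congr1 (fun v => comps p v (hidx (lift ord0 t)))).
  have phiE u : phi q p u (e (hidx (i4 1)) p) =
      Q_section q (fun r _ => qc_eta q r p u) p (e (hidx (i4 1)) p) by [].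
  rewrite !phiE !(Q_section_comps coframe) !(comps_frame coframe) !sum3 /= !eta_ofE.
  rewrite /D /qc_endo !lshift3E /coframe_comps.
  by elim/ord3P: t; rewrite rshift4E /=; lra.
apply: (comps_ext coframe); [exact: tN|exact: tn|].
apply/funext => k; suff : D i j k = 0 by rewrite /D; lra.
have [a ->|s ->] := split_ordP (j : 'I_(4 + 3)); first exact: DH.
by have [c ->|t ->] := split_ordP (k : 'I_(4 + 3)); [exact: DVH|exact: DVV].
Qed.

Theorem nabla_is_the_biquard : is_the_biquard_connection q nabla.
Proof.
by split; [exact: nabla_is_biquard|move=> N bN A B; exact: nabla_unique].
Qed.

End BiquardUniqueness.

(** * Curvature *)

Section OrthonormalTraces.
Context (R : realType) (O : 'I_4 -> 'I_4 -> R).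
Hypothesis orth : forall a b, \sum_(i < 4) O a i * O b i = (a == b)%:R.

Lemma orthonormal_columns i j : \sum_(a < 4) O a i * O a j = (i == j)%:R.
Proof.
pose M : 'M[R]_4 := \matrix_(a, i) O a i.
have MM : M *m M^T = 1%:M.
  apply/matrixP => a b; rewrite !mxE -orth; apply: eq_bigr => k _.
  by rewrite !mxE.
have := mulmx1C MM => /matrixP/(_ i j); rewrite !mxE => <-.
by apply: eq_bigr => k _; rewrite !mxE.
Qed.

Let Q i j k l a b : R :=
  (O b i * O a j - O b j * O a i) * (O a k * O b l - O a l * O b k).

(** In each of the four products, the sums over a and b replace O by the
    identity matrix. *)
Lemma orthonormal_trace2 i j k l : \sum_(a < 4) \sum_(b < 4) Q i j k l a b =
  2 * ((i == l)%:R * (j == k)%:R - (i == k)%:R * (j == l)%:R).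
Proof.
have E m1 m2 m3 m4 : \sum_(a < 4) \sum_(b < 4) (O a m1 * O a m2) * (O b m3 * O b m4) =
    (m1 == m2)%:R * (m3 == m4)%:R.
  rewrite -(orthonormal_columns m1 m2) mulr_suml; apply: eq_bigr => a _.
  by rewrite -mulr_sumr orthonormal_columns.
rewrite (eq_bigr (fun a => \sum_(b < 4) ((O a j * O a k) * (O b i * O b l) -
   (O a j * O a l) * (O b i * O b k) - (O a i * O a k) * (O b j * O b l) +
   (O a i * O a l) * (O b j * O b k)))); last first.
  by move=> a _; apply: eq_bigr => b _; rewrite /Q; ring.
under eq_bigr do rewrite big_split !sumrB.
rewrite big_split !sumrB /= !E; ring.
Qed.

End OrthonormalTraces.

Section CurvatureModel.
Context (R : realType).
Implicit Types (x y z w : 'I_7 -> R).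

Local Notation wd x y i j := (x (i7 i) * y (i7 j) - x (i7 j) * y (i7 i)).

(** The curvature tensor of the Biquard connection on H. *)
Definition L2_Rm x y z w : R :=
  wd x y 1 2 * (wd z w 1 2 - 2^-1 * wd z w 3 4)
  + wd x y 3 4 * (wd z w 3 4 - 2^-1 * wd z w 1 2)
  + 4^-1 * ((wd x y 1 3 - wd x y 2 4) * (wd z w 1 3 - wd z w 2 4))
  + 4^-1 * ((wd x y 1 4 + wd x y 2 3) * (wd z w 1 4 + wd z w 2 3)).

End CurvatureModel.

Section L2Curvature.
Context (R : realType) (G : lieGroup R 7).
Context (th : 'I_7 -> oneform G) (e : 'I_7 -> vfield G).
Hypothesis coframe : is_coframe th e.
Hypothesis th_L2 : L2_equations th.
Implicit Types (p : G) (u v : tvec G) (X Y Z W A B U : vfield G).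

Local Notation q := (qc_of_coframe th e).
Local Notation comps := (coframe_comps th).
Local Notation nabla := (frame_conn th e (@L2_christoffel R)).

Lemma Rm_hor X Y Z W p :
  hor_field q X -> hor_field q Y -> hor_field q Z -> hor_field q W ->
  Rm q nabla X Y Z W p =
  L2_Rm (comps p (X p)) (comps p (Y p)) (comps p (Z p)) (comps p (W p)).
Proof.
move=> [sX hX] [sY hY] [sZ hZ] [sW hW].
have [x5 x6 x7] := hor_comps (hX p); have [y5 y6 y7] := hor_comps (hY p).
have [z5 z6 z7] := hor_comps (hZ p); have [w5 w6 w7] := hor_comps (hW p).
rewrite /Rm qc_gE sum7 w5 w6 w7 !mulr0 !addr0.
rewrite {1 3 5 7}/coframe_comps
  !(curvature_comp coframe (L2_differential th_L2) _ _ _ sX sY sZ).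
have nabE x y : bilin (@L2_christoffel R) x y = L2_conn x y by apply/funext => k;
  exact: L2_connE.
rewrite !nabE /L2_conn /L2_form /= ?x5 ?x6 ?x7 ?y5 ?y6 ?y7 ?z5 ?z6 ?z7 /L2_Rm.
by field.
Qed.

(** Only the diagonal terms of the curvature, as a symmetric form on 2-forms,
    contribute: the trace is - 2 (1 + 1 + 1/2 + 1/2) = - 6. *)
Theorem L2_qc_scalar : is_qc_scalar q nabla (fun=> - 4^-1).
Proof.
move=> p E [hE oE].
pose O a i := comps p (E a p) (lshift 3 i : 'I_(4 + 3)).
have orth a b : \sum_(i < 4) O a i * O b i = (a == b)%:R.
  rewrite -oE qc_gE (@big_split_ord _ _ _ 4 3) /= [X in _ + X]big1 ?addr0// => s _.
  have [h5 h6 h7] := hor_comps ((hE a).2 p).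
  by elim/ord3P: s; rewrite rshift4E ?h5 ?h6 ?h7 mul0r.
pose Q i j k l a b : R :=
  (O b i * O a j - O b j * O a i) * (O a k * O b l - O a l * O b k).
have TE i j k l := orthonormal_trace2 orth i j k l.
pose S (F : 'I_4 -> 'I_4 -> R) := \sum_(a < 4) \sum_(b < 4) F a b.
have SD F H : S (fun a b => F a b + H a b) = S F + S H.
  by rewrite /S -big_split; apply: eq_bigr => a _; rewrite -big_split.
have SZ c F : S (fun a b => c * F a b) = c * S F.
  by rewrite /S mulr_sumr; apply: eq_bigr => a _; rewrite mulr_sumr.
have SQ i j k l : S (Q i j k l) =
    2 * ((i == l)%:R * (j == k)%:R - (i == k)%:R * (j == l)%:R) by exact: TE.
transitivity (S (fun a b =>
  Q (i4 1) (i4 2) (i4 1) (i4 2) a b + (- 2^-1) * Q (i4 1) (i4 2) (i4 3) (i4 4) a b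
  + (Q (i4 3) (i4 4) (i4 3) (i4 4) a b + (- 2^-1) * Q (i4 3) (i4 4) (i4 1) (i4 2) a b)
  + 4^-1 * (Q (i4 1) (i4 3) (i4 1) (i4 3) a b + (-1) * Q (i4 1) (i4 3) (i4 2) (i4 4) a b
            + (-1) * Q (i4 2) (i4 4) (i4 1) (i4 3) a b + Q (i4 2) (i4 4) (i4 2)
              (i4 4) a b)
  + 4^-1 * (Q (i4 1) (i4 4) (i4 1) (i4 4) a b + Q (i4 1) (i4 4) (i4 2) (i4 3) a b
            + Q (i4 2) (i4 3) (i4 1) (i4 4) a b + Q (i4 2) (i4 3) (i4 2) (i4 3) a b))).
  by rewrite !(SD, SZ) !SQ /=; field.
apply: eq_bigr => a _; apply: eq_bigr => b _.
rewrite (Rm_hor p (hE b) (hE a) (hE a) (hE b)) /L2_Rm /Q /O !lshift3E /=.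
by field.
Qed.

Theorem L2_W_neq0 (p : G) : exists X Y Z W p,
  [/\ hor_field q X, hor_field q Y, hor_field q Z, hor_field q W
    & qc_W q nabla (fun=> - 4^-1) X Y Z W p <> 0].
Proof.
have h1 : hor_field q (e (i7 1)) by have := hframe_hor coframe (i4 1); rewrite lshift3E.
have h2 : hor_field q (e (i7 2)) by have := hframe_hor coframe (i4 2); rewrite lshift3E.
exists (e (i7 1)), (e (i7 2)), (e (i7 1)), (e (i7 2)), p; split=> //.
have hI s X : hor_field q X -> hor_field q (I_field q s X).
  move=> [sX hX]; split=> [|r]; first exact: (I_field_smooth coframe).
  exact: (qc_I_hor coframe).
have T00 X Y : hor_field q X -> T0 q nabla X Y p = 0.
  move=> hX; rewrite /T0 qc_gE big1// => i _.
  rewrite [X in comps p X](_ : _ = 0) ?/coframe_comps ?(coframe0 coframe) ?mul0r//.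
  apply: big1 => s _; apply: (nabla_torsion_ver coframe th_L2); last exact: hI.
  by have := vframe_ver coframe s.
have RI s : Rm q nabla (I_field q s (e (i7 1))) (I_field q s (e (i7 2)))
    (e (i7 1)) (e (i7 2)) p =
    L2_Rm (qc_endo s (comps p (e (i7 1) p))) (qc_endo s (comps p (e (i7 2) p)))
      (comps p (e (i7 1) p)) (comps p (e (i7 2) p)).
  by rewrite (Rm_hor p (hI s _ h1) (hI s _ h2) h1 h2) !(qc_I_comps coframe).
have TI s : T0 q nabla (e (i7 1)) (I_field q s (e (i7 2))) p -
    T0 q nabla (I_field q s (e (i7 1))) (e (i7 2)) p = 0.
  by rewrite (T00 _ _ h1) (T00 _ _ (hI s _ h1)) subrr.
have om s u v : qc_omega q s p u v = \sum_(i < 7) qc_endo s (comps p u) i * comps p v i.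
  by rewrite /qc_omega qc_gE (qc_I_comps coframe).
rewrite /qc_W (Rm_hor p h1 h2 h1 h2) !sum3 !RI !TI /star !om !qc_gE !sum7.
rewrite !(comps_frame coframe) /L2_Rm /qc_endo /=.
have half r : r = 2^-1 :> R -> r <> 0.
  by move=> ->; apply/eqP; rewrite invr_eq0 pnatr_eq0.
by apply: half; field.
Qed.

End L2Curvature.

(** * Pulling back a coframe *)

Section SeparatingFunctions.
Context (R : realType) (n : nat) (M : manifold R n).
Context (th : 'I_n -> oneform M) (e : 'I_n -> vfield M).
Hypothesis coframe : is_coframe th e.

(** The frame vectors at p are independent functionals on germs, so that some n
    germs separate them. These germs play the part of coordinates. *)
Lemma frame_separating (p : M) : exists f : 'I_n -> M -> R,
  (forall j, smooth_at p (f j)) /\ (\matrix_(i, j) (e i p (f j) : R)) \in unitmx.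
Proof.
suff /(_ n (leqnn n))[f [sf rf]] : forall r, (r <= n)%N -> exists f : 'I_r -> M -> R,
    (forall j, smooth_at p (f j)) /\
    row_free (\matrix_(j, i) (e i p (f j) : R)).
  exists f; split=> //; rewrite -unitmx_tr -row_free_unit.
  by rewrite (_ : _^T = \matrix_(j, i) (e i p (f j) : R))//; apply/matrixP => i j;
    rewrite !mxE.
(* A vector c killed by the first r functions gives a nonzero combination of
   the e_i, which some further function h detects. *)
elim=> [|r IH] rn.
  exists (fun _ _ => 0); split=> [j|]; first exact: smooth_at_cst.
  by rewrite /row_free eqn_leq rank_leq_row.
have [f [sf rf]] := IH (ltnW rn); set D := \matrix_(j, i) _ in rf.
have [c Dc c0] : exists2 c : 'cV[R]_n, D *m c = 0 & c != 0.
  have : cokermx D != 0.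
    by rewrite -mxrank_eq0 mxrank_coker (eqP rf) subn_eq0 -ltnNge.
  move/matrix0Pn => [i [j cij]]; exists (col j (cokermx D)).
    by rewrite colE mulmxA mulmx_coker mul0mx.
  by apply/eqP => /matrixP/(_ i ord0); rewrite mxE [RHS]mxE => h; rewrite h eqxx in cij.
have [h sh hc] : exists2 h, smooth_at p h &
    \sum_(i < n) c i ord0 * (e i p h : R) != 0.
  apply: contrapT => nh; move/eqP: c0; apply.
  have v0 : \sum_(i < n) c i ord0 *: e i p = 0 :> tvec M.
    apply/funext => h; have [sh|nsh] := pselect (smooth_at p h); last first.
      rewrite tvec_sumE big1// => i _.
      by rewrite tvecZE (tangent_junk (frame_tangent coframe i p) nsh) mulr0.
    by rewrite tvec_sumE; apply/eqP/negP => /negP nz; apply: nh; exists h.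
  apply/matrixP => i j; rewrite ord1 mxE
    -(coframe_comb coframe i p (fun i => c i ord0)).
  by rewrite v0 (coframe0 coframe).
pose f' (j : 'I_r.+1) := if unlift ord_max j is Some k then f k else h.
exists f'; split=> [j|]; first by rewrite /f'; case: unlift.
rewrite -kermx_eq0; apply/eqP/row_matrixP => a; rewrite row0.
set K := kermx _.
have : row a K *m \matrix_(j, i) (e i p (f' j) : R) = 0.
  by rewrite -row_mul mulmx_ker row0.
move: (row a K) => x xK.
have xE i : \sum_(j < r) x ord0 (lift ord_max j) * (e i p (f j) : R) +
  x ord0 ord_max * (e i p h : R) = 0.
  move/matrixP: xK => /(_ ord0 i); rewrite !mxE big_ord_recr /= => xK.
  rewrite -[RHS]xK; congr (_ + _).
    apply: eq_bigr => j _; rewrite mxE /f'.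
    have -> : widen_ord (leqnSn r) j = lift ord_max j.
      by apply: val_inj; rewrite /= /bump leqNgt ltn_ord.
    by rewrite liftK.
  by rewrite mxE /f' unlift_none.
have xm : x ord0 ord_max = 0.
  have : \sum_(i < n) c i ord0 * (\sum_(j < r) x ord0 (lift ord_max j)
    * (e i p (f j) : R) + x ord0 ord_max * (e i p h : R)) = 0.
    by rewrite big1// => i _; rewrite xE mulr0.
  under eq_bigr do rewrite mulrDr mulr_sumr.
  rewrite big_split exchange_big /= big1 ?add0r; last first.
    move=> j _; move/matrixP: Dc => /(_ j ord0); rewrite !mxE => Dc.
    rewrite -[RHS](mulr0 (x ord0 (lift ord_max j))) -{2}Dc mulr_sumr.
    by apply: eq_bigr => i _; rewrite mxE; ring.
  move=> hx; have : x ord0 ord_max * \sum_(i < n) c i ord0 * (e i p h : R) = 0.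
    by rewrite -[RHS]hx mulr_sumr; apply: eq_bigr => i _; ring.
  by move/eqP; rewrite mulf_eq0 (negbTE hc) orbF => /eqP.
pose y : 'rV[R]_r := \row_j x ord0 (lift ord_max j).
have yD : y *m D = 0.
  apply/matrixP => i j; rewrite ord1 !mxE -[RHS](xE j) xm mul0r addr0.
  by apply: eq_bigr => k _; rewrite !mxE.
have y0 : y = 0.
  by apply: (row_free_inj rf); rewrite yD mul0mx.
apply/matrixP => i j; rewrite ord1 [RHS]mxE.
case: (unliftP ord_max j) => [k ->|-> //].
by move/matrixP: y0 => /(_ ord0 k); rewrite !mxE.
Qed.

End SeparatingFunctions.

Section Pullback.
Context (R : realType) (m n : nat) (M : manifold R m) (N : manifold R n).
Context (th : 'I_m -> oneform M) (e : 'I_m -> vfield M).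
Context (th' : 'I_n -> oneform N) (e' : 'I_n -> vfield N).
Hypotheses (coframe : is_coframe th e) (coframe' : is_coframe th' e').
Context (U : set M) (F : M -> N).
Hypotheses (oU : open U) (sF : forall x, U x -> smooth_map_at F x).

Definition frame_jacobian (i : 'I_n) (b : 'I_m) (y : M) : R :=
  th' i (F y) (differential F y (e b y)).

Lemma jacobian_derive b y f : U y -> smooth_at (F y) f ->
  e b y (f \o F) = \sum_(i < n) frame_jacobian i b y * e' i (F y) f.
Proof.
move=> Uy sf.
have td := differential_tangent (sF Uy) (frame_tangent coframe b y).
rewrite -(tangent_expand coframe' f td) /differential.
by case: asboolP.
Qed.

Lemma smooth_map_near x f : U x -> smooth_at (F x) f -> \forall y \near x,
  U y /\ smooth_at (F y) f.
Proof.
move=> Ux sf; have := near_open oU Ux (fun y => @id (U y)).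
have [cF _] := sF Ux; have := smooth_at_near sf => /cF h1 h2.
by apply: filterS2 h2 h1.
Qed.

(** The coefficients solve the linear system given by the derivatives of n
    separating functions composed with F, which is invertible near x. *)
Lemma jacobian_smooth i b x : U x -> smooth_at x (frame_jacobian i b).
Proof.
move=> Ux; have [f [sf Df]] := frame_separating coframe' (F x).
pose D (y : M) := \matrix_(i, j) (vf_app (e' i) (f j) (F y) : R).
pose E (y : M) := \row_j (vf_app (e b) (f j \o F) y : R).
have sD k j : smooth_at x (fun y => D y k j).
  apply: (@smooth_at_eq _ _ _ _ (vf_app (e' k) (f j) \o F)).
    by have [_] := sF Ux; apply; exact: ((frame_smooth coframe' k).2 _ _ (sf j)).
  by apply: nearW => y; rewrite mxE.
have sE j : smooth_at x (fun y => E y ord0 j).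
  apply: (@smooth_at_eq _ _ _ _ (vf_app (e b) (f j \o F))).
    by apply: (frame_smooth coframe b).2; have [_] := sF Ux; apply.
  by apply: nearW => y; rewrite mxE.
have sDet := smooth_at_det sD.
have Dx0 : \det (D x) != 0 by rewrite -unitfE -unitmxE.
have nD := smooth_at_neq0 sDet Dx0.
have nf : \forall y \near x, forall j, U y /\ smooth_at (F y) (f j).
  by apply: filter_forall => j; exact: smooth_map_near.
apply: (@smooth_at_eq _ _ _ _ (fun y => (E y *m invmx (D y)) ord0 i)).
  apply: (@smooth_at_eq _ _ _ _ (fun y => \sum_(j < n) E y ord0 j * invmx (D y) j i)).
    apply: smooth_at_sum => j _; apply: smooth_atM; first exact: sE.
    by apply: smooth_at_invmx => //; rewrite unitmxE unitfE.
  by apply: nearW => y; rewrite mxE.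
apply: filterS2 nD nf => y Dy fy.
have EA : E y = (\row_k frame_jacobian k b y) *m D y.
  apply/matrixP => a j; rewrite ord1 !mxE [LHS](jacobian_derive b (fy j).1 (fy j).2).
  by apply: eq_bigr => k _; rewrite !mxE.
rewrite EA -mulmxA mulmxV ?mulmx1 ?mxE// unitmxE unitfE.
exact: Dy.
Qed.

Section Structure.
Context (w : 'I_m -> ('I_m -> R) -> ('I_m -> R) -> R).
Context (w' : 'I_n -> ('I_n -> R) -> ('I_n -> R) -> R).
Hypothesis dth : forall k,
  has_differential (th k) (fun p u v => w k (coframe_comps th p u)
    (coframe_comps th p v)).
Hypothesis dth' : forall k,
  has_differential (th' k) (fun p u v => w' k (coframe_comps th' p u)
    (coframe_comps th' p v)).
Hypothesis w'_bilinear : forall i x y, w' i x y =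
  \sum_(j < n) \sum_(l < n) x j * y l * w' i (fun k => (k == j)%:R)
    (fun k => (k == l)%:R).

(** That d commutes with pullback, in components. The fields F_* e_a are not
    defined off the image of F, so the commutator of e_a and e_b is computed on
    functions f o F instead. *)
Lemma jacobian_structure i a b y : U y ->
  e a y (frame_jacobian i b) - e b y (frame_jacobian i a) =
  w' i (fun j => frame_jacobian j a y) (fun j => frame_jacobian j b y)
  - \sum_(k < m) frame_jacobian i k y * w k (fun j => (j == a)%:R)
    (fun j => (j == b)%:R).
Proof.
move=> Uy; pose Fy := F y.
have sa := frame_smooth coframe a; have sb := frame_smooth coframe b.
have te' k := frame_tangent coframe' k Fy.
have tb' j l := bracket_tangent Fy (frame_smooth coframe' j) (frame_smooth coframe' l).
pose T1 : tvec N := \sum_(l < n)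
  (e a y (frame_jacobian l b) - e b y (frame_jacobian l a)) *: e' l Fy +
  \sum_(j < n) \sum_(l < n) (frame_jacobian j a y * frame_jacobian l b y) *: bracket
    (e' j) (e' l) Fy.
pose T2 : tvec N := \sum_(l < n)
  (\sum_(k < m) th k y (bracket (e a) (e b) y) * frame_jacobian l k y) *: e' l Fy.
have t11 : tangent Fy (\sum_(l < n)
  (e a y (frame_jacobian l b) - e b y (frame_jacobian l a)) *: e' l Fy).
  by apply: tangent_sum => l _; exact: tangentZ.
have t12j j : tangent Fy (\sum_(l < n) (frame_jacobian j a y * frame_jacobian l b y)
  *: bracket (e' j) (e' l) Fy).
  by apply: tangent_sum => l _; exact: tangentZ.
have t12 : tangent Fy (\sum_(j < n) \sum_(l < n)
  (frame_jacobian j a y * frame_jacobian l b y) *: bracket (e' j) (e' l) Fy).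
  by apply: tangent_sum => j _; exact: t12j.
have t1 : tangent Fy T1 by exact: tangentD.
have t2 : tangent Fy T2 by apply: tangent_sum => l _; exact: tangentZ.
have T12 : T1 = T2.
  apply/funext => f; have [sf|nsf] := pselect (smooth_at Fy f); last first.
    by rewrite (tangent_junk t1 nsf) (tangent_junk t2 nsf).
  have sfF := (sF Uy).2 _ sf.
  have se'f l : smooth_at Fy (vf_app (e' l) f) := (frame_smooth coframe' l).2 Fy f sf.
  have se'fF l := (sF Uy).2 _ (se'f l).
  have step c d : e c y (vf_app (e d) (f \o F)) =
      \sum_(l < n) (e c y (frame_jacobian l d) * e' l Fy f +
         frame_jacobian l d y * \sum_(j < n) frame_jacobian j c y * e' j Fy
           (vf_app (e' l) f)).
    have tc := frame_tangent coframe c y.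
    have sterm l := smooth_atM (jacobian_smooth l d Uy) (se'fF l).
    rewrite (@tangent_germ _ _ _ _ _ tc _
      (fun q => \sum_(l < n) frame_jacobian l d q * (vf_app (e' l) f \o F) q)).
    - rewrite (tangent_bigsum tc _ sterm); apply: eq_bigr => l _.
      rewrite (tangent_leibniz tc (jacobian_smooth l d Uy) (se'fF l)).
      by rewrite (jacobian_derive c Uy (se'f l)).
    - exact: (frame_smooth coframe d).2.
    - apply: filterS (smooth_map_near Uy sf) => q [Uq sfq].
      exact: (jacobian_derive d Uq sfq).
  have br : bracket (e a) (e b) y (f \o F) = T2 f.
    rewrite (tangent_expand coframe (f \o F) (bracket_tangent y sa sb)) /T2 tvec_sumE.
    under eq_bigr do rewrite (jacobian_derive _ Uy sf) mulr_sumr.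
    rewrite exchange_big; apply: eq_bigr => l _ /=.
    by rewrite tvecZE mulr_suml; apply: eq_bigr => k _; rewrite mulrA.
  rewrite -br (bracketE _ _ sfF) !step /T1 tvecDE !tvec_sumE -sumrB.
  under [in RHS]eq_bigr do rewrite opprD addrACA -mulrBl.
  rewrite big_split /=; congr (_ + _).
  under eq_bigr do rewrite tvec_sumE.
  under [in LHS]eq_bigr do under eq_bigr do rewrite tvecZE (bracketE _ _ sf) mulrBr.
  under [in LHS]eq_bigr do rewrite sumrB.
  rewrite !sumrB; congr (_ - _).
    rewrite exchange_big; apply: eq_bigr => l _ /=; rewrite mulr_sumr.
    by apply: eq_bigr => j _; ring.
  apply: eq_bigr => l _ /=; rewrite mulr_sumr.
  by apply: eq_bigr => j _; ring.
have := congr1 (th' i Fy) T12.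
rewrite /T1 /T2 (coframe_D coframe' i t11 t12) !(coframe_comb coframe')
  (coframe_sum coframe' i _ t12j).
move=> h.
have -> : e a y (frame_jacobian i b) - e b y (frame_jacobian i a) =
    (\sum_(k < m) th k y (bracket (e a) (e b) y) * frame_jacobian i k y) -
    \sum_(j < n) th' i Fy (\sum_(l < n)
      (frame_jacobian j a y * frame_jacobian l b y) *: bracket (e' j) (e' l) Fy).
  by rewrite -h addrK.
rewrite addrC w'_bilinear -sumrN -[X in _ = _ + X]sumrN; congr (_ + _).
  apply: eq_bigr => j _.
  rewrite (coframe_sum coframe') => [|l]; last exact: tangentZ.
  rewrite -sumrN; apply: eq_bigr => l _.
  by rewrite (coframe_Z coframe' _ _ (tb' j l)) (frame_bracket coframe' dth'); ring.
by apply: eq_bigr => k _; rewrite (frame_bracket coframe dth); ring.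
Qed.

End Structure.

End Pullback.

(** * Linear algebra of quaternionic triples *)

Section QuaternionicTriples.
Context (R : realType).

Definition omega_coef (s : 'I_3) (a b : 'I_4) : R :=
  match val s, val a, val b with
  | 0, 0, 1 => 1 | 0, 1, 0 => -1 | 0, 2, 3 => 1 | 0, 3, 2 => -1
  | 1, 0, 2 => 1 | 1, 2, 0 => -1 | 1, 3, 1 => 1 | 1, 1, 3 => -1
  | 2, 0, 3 => 1 | 2, 3, 0 => -1 | 2, 1, 2 => 1 | 2, 2, 1 => -1
  | _, _, _ => 0
  end.

Definition omega_mx (r : 'I_3 -> R) : 'M[R]_4 :=
  \matrix_(a, b) \sum_(s < 3) r s * omega_coef s a b.

Definition cross (r t : 'I_3 -> R) (s : 'I_3) : R :=
  match val s with
  | 0 => r (i3 2) * t (i3 3) - r (i3 3) * t (i3 2)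
  | 1 => r (i3 3) * t (i3 1) - r (i3 1) * t (i3 3)
  | _ => r (i3 1) * t (i3 2) - r (i3 2) * t (i3 1)
  end.

Definition dot (r t : 'I_3 -> R) : R := \sum_(s < 3) r s * t s.

Lemma omega_mx_mul r t : omega_mx r *m omega_mx t =
  (- dot r t)%:M - omega_mx (cross r t).
Proof.
apply/matrixP => a b; rewrite !mxE sum4 !mxE !sum3 /dot /cross /omega_coef sum3.
by elim/ord4P: a; elim/ord4P: b; rewrite /= ?mulr0n ?mulr1n; ring.
Qed.

(** Pulling back a quaternionic triple of 2-forms to a rotated and rescaled
    triple forces a linear map to be conformal: the triple determines the
    metric. *)
Lemma conformal_orthogonal (B : 'M[R]_4) (mu : R) (r : 'I_3 -> 'I_3 -> R) :
  mu != 0 ->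
  (forall s, dot (r s) (r s) = 1) -> dot (r (i3 1)) (r (i3 2)) = 0 ->
  cross (r (i3 1)) (r (i3 2)) = r (i3 3) ->
  (forall s, B^T *m omega_mx (fun t => (t == s)%:R) *m B = mu *: omega_mx (r s)) ->
  B^T *m B = mu%:M.
Proof.
move=> mu0 rr r12 r123 BJ.
pose J s := omega_mx (fun t => (t == s)%:R); pose P s := omega_mx (r s).
have crossxx x : cross x x = fun=> 0.
  by apply/funext; elim/ord3P; rewrite /cross /=; ring.
have J0 : omega_mx (fun=> 0) = 0.
  by apply/matrixP => a b; rewrite !mxE big1// => s _; rewrite mul0r.
have PP s : P s *m P s = (-1)%:M by rewrite omega_mx_mul rr crossxx J0 subr0.
have JJ s : J s *m J s = (-1)%:M.
  rewrite omega_mx_mul crossxx J0 subr0; congr (- _)%:M.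
  by rewrite /dot sum3; elim/ord3P: s => /=; ring.
have NN (T : 'I_3 -> 'M[R]_4) : (forall s, T s *m T s = (-1)%:M) ->
    forall s, T s *m (- T s) = 1%:M.
  by move=> TT s; rewrite mulmxN TT -raddfN opprK.
have P12 : P (i3 1) *m P (i3 2) =
  - P (i3 3) by rewrite omega_mx_mul r12 r123 oppr0 raddf0 sub0r.
have J12 : J (i3 1) *m J (i3 2) = - J (i3 3).
  rewrite omega_mx_mul (_ : dot _ _ = 0); last by rewrite /dot sum3 /=; ring.
  rewrite oppr0 raddf0 sub0r; congr (- omega_mx _).
  by apply/funext; elim/ord3P; rewrite /cross /=; ring.
have E1 : (B *m P (i3 1)) *m (B^T *m J (i3 1)) = (- mu)%:M.
  have h : (- mu^-1 *: (B^T *m J (i3 1))) *m (B *m P (i3 1)) = 1%:M.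
    rewrite -scalemxAl mulmxA BJ -scalemxAl PP !scale_scalar_mx.
    by congr (_%:M); field.
  have := mulmx1C h; rewrite -scalemxAr => /(congr1 (fun X => - mu *: X)).
  rewrite scalerA (_ : - mu * - mu^-1 = 1) ?scale1r; last by field.
  by rewrite scale_scalar_mx mulr1.
have E2 : B *m P (i3 1) *m B^T = mu *: J (i3 1).
  have h : B *m P (i3 1) *m B^T *m J (i3 1) = (- mu)%:M by rewrite -E1 !mulmxA.
  by rewrite -[LHS]mulmx1 -(NN _ JJ (i3 1)) mulmxA h mul_scalar_mx scalerN scaleNr
    opprK.
have E3 : J (i3 3) *m B = B *m P (i3 3).
  have : B *m P (i3 1) *m (B^T *m J (i3 2) *m B) = mu *: (B *m (P (i3 1) *m P (i3 2))).
    by rewrite BJ -scalemxAr mulmxA.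
  rewrite P12 !mulmxA E2 -!scalemxAl -mulmxA.
  move/(scalerI mu0); rewrite mulmxA J12 mulNmx mulmxN => /oppr_inj.
  by [].
have E4 : B^T *m B *m P (i3 3) = mu *: P (i3 3).
  by rewrite -mulmxA -E3 mulmxA BJ.
by rewrite -[LHS]mulmx1 -(NN _ PP (i3 3)) mulmxA E4 -scalemxAl NN// scalemx1.
Qed.

Lemma det_mx3 (f : nat -> nat -> R) : \det (\matrix_(i < 3, j < 3) f i j) =
  f 0%N 0%N * (f 1%N 1%N * f 2%N 2%N - f 1%N 2%N * f 2%N 1%N)
  - f 0%N 1%N * (f 1%N 0%N * f 2%N 2%N - f 1%N 2%N * f 2%N 0%N)
  + f 0%N 2%N * (f 1%N 0%N * f 2%N 1%N - f 1%N 1%N * f 2%N 0%N).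
Proof.
rewrite (expand_det_row _ ord0) !big_ord_recl big_ord0 /cofactor.
rewrite !(expand_det_row _ ord0) !big_ord_recl !big_ord0 /cofactor.
rewrite !det_mx11 !mxE /= /bump /= ?addn0 ?addn1 ?expr0 ?expr1 ?expr2.
rewrite /bump /=.
ring.
Qed.

Lemma rotation_cross (Psi : 'M[R]_3) : Psi *m Psi^T = 1%:M -> \det Psi = 1 ->
  [/\ forall s, dot (Psi s) (Psi s) = 1, dot (Psi (i3 1)) (Psi (i3 2)) = 0
    & cross (Psi (i3 1)) (Psi (i3 2)) = Psi (i3 3)].
Proof.
move=> /matrixP PP dP.
have E s t : dot (Psi s) (Psi t) = (s == t)%:R.
  have := PP s t; rewrite !mxE => <-; apply: eq_bigr => k _.
  by rewrite !mxE.
split; [by move=> s; rewrite E eqxx|by rewrite E|].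
set c := cross _ _.
have c3 : dot c (Psi (i3 3)) = 1.
  rewrite -dP (_ : Psi = \matrix_(i, j) Psi (inord i) (inord j)); last first.
    by apply/matrixP => i j; rewrite !mxE !inord_val.
  rewrite (det_mx3 (fun i j => Psi (inord i) (inord j))).
  have e0 : inord 0 = i3 1 by apply: val_inj; rewrite /= inordK.
  have e1 : inord 1 = i3 2 by apply: val_inj; rewrite /= inordK.
  have e2 : inord 2 = i3 3 by apply: val_inj; rewrite /= inordK.
  rewrite e0 e1 e2 /dot sum3 /c /cross /= !mxE !inord_val; ring.
have cc : dot c c = 1.
  have : dot c c = dot (Psi (i3 1)) (Psi (i3 1)) * dot (Psi (i3 2)) (Psi (i3 2))
     - dot (Psi (i3 1)) (Psi (i3 2)) ^+ 2.
    by rewrite /dot !sum3 /c /cross /=; ring.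
  by move=> ->; rewrite !E /= expr0n subr0 mulr1.
have dd : \sum_(s < 3) (c s - Psi (i3 3) s) ^+ 2 = 0.
  have -> : \sum_(s < 3) (c s - Psi (i3 3) s) ^+ 2 =
      dot c c - 2 * dot c (Psi (i3 3)) + dot (Psi (i3 3)) (Psi (i3 3)).
    by rewrite /dot !sum3; ring.
  by rewrite cc c3 E eqxx /=; ring.
apply/funext => s; apply/eqP; rewrite -subr_eq0 -sqrf_eq0.
by apply/eqP; apply: (psumr_eq0P (fun j _ => sqr_ge0 (c j - Psi (i3 3) j)) dd).
Qed.

End QuaternionicTriples.

(** * The conformal change of the connection *)

Section ConformalAlgebra.
Context (R : realType).
Implicit Types (v : 'I_4 -> R).

(** The coefficient of d e^c on the horizontal vectors e_a, e_b. *)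
Definition L2_hor_coef (c a b : 'I_4) : R :=
  match val c, val a, val b with
  | 1, 0, 1 => -1 | 1, 1, 0 => 1 | 1, 2, 3 => 1 | 1, 3, 2 => -1
  | 2, 0, 2 => - 2^-1 | 2, 2, 0 => 2^-1
  | 3, 0, 3 => - 2^-1 | 3, 3, 0 => 2^-1
  | _, _, _ => 0
  end.

(** For a coframe theta' with d eta' = 2 omega' and eta' = mu Psi eta, written
    as theta' = B (e + K eta), this is K as a function of v = d (ln mu) / 2. *)
Definition conf_K v (d : 'I_4) (t : 'I_3) :
  R := - \sum_(c < 4) omega_coef R t d c * v c.

(** The torsion that B^-1 (e_a B) - v_a must have in order that theta' be
    closed. *)
Definition conf_T v (c a b : 'I_4) : R :=
  - L2_hor_coef c a b - 2 * \sum_(t < 3) conf_K v c t * omega_coef R t a b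
  - v a * (c == b)%:R + v b * (c == a)%:R.

(** B^-1 (e_a B) in terms of v = (x, y, z, t): the derivative of a conformal map
    that makes theta' closed. Entry b of row c of the a-th block. *)
Definition conf_blocks (x y z t : R) : seq (seq (seq R)) :=
  [:: [:: [::     x;  3 * y;  3 * z;  3 * t];
          [:: -3 * y;     x;    - t;      z];
          [:: -3 * z;     t;      x;    - y];
          [:: -3 * t;   - z;      y;      x]];
      [:: [::     y; 1 - 3 * x;   t;    - z];
          [:: 3 * x - 1;  y;  3 * z;  3 * t];
          [::   - t; -3 * z;      y; x - 2^-1];
          [::     z; -3 * t; 2^-1 - x;    y]];
      [:: [::     z;    - t; 2^-1 - 3 * x; y];
          [::     t;      z; -3 * y; - 2^-1 - x];
          [:: 3 * x - 2^-1; 3 * y; z; 3 * t];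
          [::   - y; x + 2^-1; -3 * t;    z]];
      [:: [::     t;      z;    - y; 2^-1 - 3 * x];
          [::   - z;      t; x + 2^-1; -3 * y];
          [::     y; - 2^-1 - x;  t; -3 * z];
          [:: 3 * x - 2^-1; 3 * y; 3 * z; t]]].

Definition conf_M v (a c b : 'I_4) : R :=
  nth 0 (nth [::] (nth [::] (conf_blocks (v (i4 1)) (v (i4 2)) (v (i4 3)) (v (i4 4)))
    a) c) b.

(** The Koszul formula for the torsion conf_T, with trace part v_a. *)
Lemma conf_M_koszul v a c b :
  v a * (c == b)%:R + 2^-1 * (conf_T v c a b + conf_T v b c a - conf_T v a b c) =
  conf_M v a c b.
Proof.
rewrite /conf_T /conf_K !sum3 !sum4.
by elim/ord4P: a; elim/ord4P: c; elim/ord4P: b;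
  rewrite /conf_M /omega_coef /L2_hor_coef /=; field.
Qed.

Definition delta4 (k : 'I_4) : 'I_4 -> R := fun c => (c == k)%:R.

Lemma conf_M_affine v a c b : conf_M v a c b =
  conf_M (fun=> 0) a c b
  + \sum_(k < 4) v k * (conf_M (delta4 k) a c b - conf_M (fun=> 0) a c b).
Proof.
rewrite /conf_M /delta4 !sum4.
by elim/ord4P: a; elim/ord4P: c; elim/ord4P: b => /=; ring.
Qed.

Lemma koszul (N T : 'I_4 -> 'I_4 -> 'I_4 -> R) :
  (forall a c b, N a c b = - N a b c) ->
  (forall a b c, N a c b - N b c a = T c a b) ->
  forall a c b, N a c b = 2^-1 * (T c a b + T b c a - T a b c).
Proof.
move=> skew tor a c b; rewrite -!tor (skew c b a) (skew b a c) (skew a b c).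
by field.
Qed.

(** B^-1 (e_a e_b - e_b e_a - [e_a, e_b]_H) B computed from e_a B = B M_a, where
    V a k stands for e_a v_k. *)
Definition conf_Z v (V : 'I_4 -> 'I_4 -> R) (a b d c : 'I_4) : R :=
  \sum_(f < 4) (conf_M v a d f * conf_M v b f c - conf_M v b d f * conf_M v a f c)
  + \sum_(k < 4) V a k * (conf_M (delta4 k) b d c - conf_M (fun=> 0) b d c)
  - \sum_(k < 4) V b k * (conf_M (delta4 k) a d c - conf_M (fun=> 0) a d c)
  + \sum_(k < 4) L2_hor_coef k a b * conf_M v k d c.

(** The anti-self-dual 2-forms span S^2 E for the factor Sp(1) that commutes with
    Q, and the combination below is a component of Z in S^4 E. Neither the
    derivative of v in H x H nor the square of v has such a component, so all
    unknowns cancel; the constant that remains is, up to a factor, a component of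
    the qc conformal curvature. *)
Lemma conf_Z_weyl v V :
  let Z1 d c := conf_Z v V (i4 1) (i4 2) d c - conf_Z v V (i4 3) (i4 4) d c in
  let Z2 d c := conf_Z v V (i4 1) (i4 3) d c - conf_Z v V (i4 4) (i4 2) d c in
  Z1 (i4 1) (i4 2) - Z1 (i4 3) (i4 4) - (Z2 (i4 1) (i4 3) - Z2 (i4 4) (i4 2)) = - 3.
Proof.
rewrite /= /conf_Z !sum4 /conf_M /delta4 /L2_hor_coef /=.
by field.
Qed.

End ConformalAlgebra.

(** * The group is not locally flat *)

Local Notation hidx a := (lshift 3 a : 'I_(4 + 3)).
Local Notation vidx s := (rshift 4 s : 'I_(4 + 3)).

Lemma vidx_hidx s a : (vidx s == hidx a :> 'I_7) = false.
Proof. by elim/ord3P: s; elim/ord4P: a; rewrite rshift4E lshift3E. Qed.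

Lemma vidx_eq s t : (vidx s == vidx t :> 'I_7) = (s == t).
Proof. by elim/ord3P: s; elim/ord3P: t; rewrite !rshift4E. Qed.

Section HeisenbergModel.
Context (R : realType).
Implicit Types (x y : 'I_7 -> R).

Definition delta7 (k : 'I_7) : 'I_7 -> R := fun j => (j == k)%:R.

Definition H_form (k : 'I_7) x y : R :=
  match val k with
  | 4 => 2 * om_form (i3 1) x y
  | 5 => 2 * om_form (i3 2) x y
  | 6 => 2 * om_form (i3 3) x y
  | _ => 0
  end.

Lemma H_form_h a x y : H_form (hidx a) x y = 0.
Proof. by elim/ord4P: a. Qed.

Lemma H_form_v s x y : H_form (vidx s) x y = 2 * om_form s x y.
Proof. by elim/ord3P: s. Qed.

Lemma om_form_sum s x y : om_form s x y =
  \sum_(i < 4) \sum_(j < 4) omega_coef R s i j * (x (hidx i) * y (hidx j)).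
Proof.
rewrite !sum4 !lshift3E /om_form /omega_coef.
by elim/ord3P: s => /=; ring.
Qed.

Lemma H_form_bilinear k x y : H_form k x y =
  \sum_(j < 7) \sum_(l < 7) x j * y l * H_form k (delta7 j) (delta7 l).
Proof.
by elim/ord7P: k; rewrite !sum7 /H_form /om_form /delta7 /=; ring.
Qed.

Lemma L2_form_hhh c a b :
  L2_form (hidx c) (delta7 (hidx a)) (delta7 (hidx b)) = L2_hor_coef R c a b.
Proof.
by elim/ord4P: c; elim/ord4P: a; elim/ord4P: b;
  rewrite !lshift3E /L2_form /delta7 /L2_hor_coef /=; ring.
Qed.

Lemma L2_form_vhh t a b :
  L2_form (vidx t) (delta7 (hidx a)) (delta7 (hidx b)) = 2 * omega_coef R t a b.
Proof.
by elim/ord3P: t; elim/ord4P: a; elim/ord4P: b;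
  rewrite !lshift3E rshift4E /L2_form /delta7 /omega_coef /=; ring.
Qed.

Lemma L2_form_vhv t a :
  L2_form (vidx t) (delta7 (hidx a)) (delta7 (vidx t)) = 0 :> R.
Proof.
by elim/ord3P: t; elim/ord4P: a;
  rewrite !lshift3E !rshift4E /L2_form /delta7 /=; ring.
Qed.

End HeisenbergModel.

Section Heisenberg.
Context (R : realType) (N : lieGroup R 7) (th : 'I_7 -> oneform N).

Lemma heisenberg_differential k : heisenberg_equations th ->
  has_differential (th k) (fun p u v => H_form k (coframe_comps th p u)
    (coframe_comps th p v)).
Proof.
move=> [hh hv]; have [a ->|s ->] := split_ordP (k : 'I_(4 + 3)).
  by move=> A B sA sB p; rewrite H_form_h hh.
move=> A B sA sB p; rewrite H_form_v -omega_ofE.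
by have := hv s A B sA sB p; rewrite /eta_of => ->.
Qed.

End Heisenberg.

Section NotFlat.
Context (R : realType) (G : lieGroup R 7).
Context (th : 'I_7 -> oneform G) (e : 'I_7 -> vfield G).
Hypothesis coframe : is_coframe th e.
Hypothesis th_L2 : L2_equations th.
Context (N : lieGroup R 7) (th' : 'I_7 -> oneform N) (e' : 'I_7 -> vfield N).
Hypothesis coframe' : is_coframe th' e'.
Hypothesis heis : heisenberg_equations th'.
Context (U : set G) (F : G -> N) (mu : G -> R) (Psi : G -> 'M[R]_3).
Hypothesis oU : open U.
Hypothesis sF : forall x, U x -> smooth_map_at F x.
Hypothesis Hmu : forall x, U x -> 0 < mu x /\ smooth_at x mu.
Hypothesis HPsi : forall x, U x -> Psi x *m (Psi x)^T = 1%:M /\ \det (Psi x) = 1.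
Hypothesis Heta : forall x, U x -> forall s v, tangent x v ->
  eta_of th' s (F x) (differential F x v) =
  mu x * \sum_(t < 3) Psi x s t * eta_of th t x v.

Local Notation A := (frame_jacobian e th' F).
Local Notation B i b := (A (hidx i) (hidx b)).
Local Notation C i t := (A (hidx i) (vidx t)).
Local Notation D a := (e (hidx a)).

Let te i y : tangent y (e i y) := frame_tangent coframe i y.

Let sA i b y (Uy : U y) : smooth_at y (A i b) :=
  jacobian_smooth coframe coframe' oU sF i b Uy.

Let der_on a y (g h : G -> R) : U y -> smooth_at y h -> (forall x, U x -> g x = h x) ->
  e a y g = e a y h.
Proof.
move=> Uy sh gh; apply/esym; apply: (tangent_germ (te a y) sh).
by apply: near_open oU Uy _ => x /gh.
Qed.

Let mu_neq0 y : U y -> mu y != 0. Proof. by move=> /Hmu[/gt_eqF ->]. Qed.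

Let A_vh s b y : U y -> A (vidx s) (hidx b) y = 0.
Proof.
move=> Uy; rewrite /frame_jacobian
  -[LHS]/(eta_of th' s (F y) (differential F y (e (hidx b) y))).
rewrite Heta// big1 ?mulr0// => t _; rewrite /eta_of (coframe_frame coframe).
by rewrite vidx_hidx mulr0.
Qed.

Let A_vv s t y : U y -> A (vidx s) (vidx t) y = mu y * Psi y s t.
Proof.
move=> Uy; rewrite /frame_jacobian
  -[LHS]/(eta_of th' s (F y) (differential F y (e (vidx t) y))).
rewrite Heta//; congr (_ * _); rewrite (bigD1 t)//= /eta_of (coframe_frame coframe).
rewrite eqxx mulr1 big1 ?addr0// => r rt; rewrite (coframe_frame coframe).
by rewrite vidx_eq (negbTE rt) mulr0.
Qed.

Let structure i a b y (Uy : U y) : e a y (A i b) - e b y (A i a) =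
  H_form i (fun j => A j a y) (fun j => A j b y)
  - (\sum_(k < 4) A i (hidx k) y * L2_form (hidx k) (delta7 R a) (delta7 R b)
     + \sum_(t < 3) A i (vidx t) y * L2_form (vidx t) (delta7 R a) (delta7 R b)).
Proof.
rewrite -(@big_split_ord _ _ _ 4 3 xpredT
  (fun k => A i k y * L2_form k (delta7 R a) (delta7 R b))).
exact: (jacobian_structure coframe coframe' oU sF (L2_differential th_L2)
  (fun k => heisenberg_differential k heis) (@H_form_bilinear R) i a b Uy).
Qed.

Let Bm y : 'M[R]_4 := \matrix_(i, b) B i b y.
Let Cm y : 'M[R]_(4, 3) := \matrix_(i, t) C i t y.

Let om_mx s y (c : 'I_7) b : om_form s (fun j => A j (hidx b) y) (fun j => A j c y) =
  \sum_(i < 4) \sum_(j < 4) omega_coef R s i j * (B i b y * A (hidx j) c y).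
Proof. exact: om_form_sum. Qed.

Let omega_mx_delta s i j : omega_mx (fun t : 'I_3 => (t == s)%:R : R) i j =
  omega_coef R s i j.
Proof.
rewrite mxE (bigD1 s)//= eqxx mul1r big1 ?addr0// => t /negbTE ->.
by rewrite mul0r.
Qed.

(** The restriction to H of d eta' = 2 omega', where eta' = mu Psi eta. *)
Let B_omega s y : U y ->
  (Bm y)^T *m omega_mx (fun t => (t == s)%:R) *m Bm y = mu y *: omega_mx (Psi y s).
Proof.
move=> Uy; apply/matrixP => a b.
have := structure (vidx s) (hidx a) (hidx b) Uy.
rewrite (@der_on _ _ _ (fun=> 0) Uy (smooth_at_cst y 0) (fun x Ux => A_vh s b Ux)).
rewrite (@der_on _ _ _ (fun=> 0) Uy (smooth_at_cst y 0) (fun x Ux => A_vh s a Ux)).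
rewrite !(tangent_cst (te _ y)) subrr H_form_v om_mx [X in _ - (X + _)]big1 =>
  [|k _]; last first.
  by rewrite (A_vh s k Uy) mul0r.
rewrite add0r; under [X in _ - X]eq_bigr do rewrite (A_vv s _ Uy) L2_form_vhh.
move=> E; have {E} -> : (mu y *: omega_mx (Psi y s)) a b =
    \sum_(i < 4) \sum_(j < 4) omega_coef R s i j * (B i a y * B j b y).
  rewrite 2!mxE mulr_sumr.
  have -> : \sum_(t < 3) mu y * (Psi y s t * omega_coef R t a b) =
      2^-1 * \sum_(t < 3) mu y * Psi y s t * (2 * omega_coef R t a b).
    by rewrite mulr_sumr; apply: eq_bigr => t _; field.
  lra.
rewrite mxE exchange_big; apply: eq_bigr => j _ /=; rewrite mxE mulr_suml.
apply: eq_bigr => i _; rewrite omega_mx_delta !mxE; ring.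
Qed.

Let BtB y : U y -> (Bm y)^T *m Bm y = (mu y)%:M.
Proof.
move=> Uy; have [P1 P2] := HPsi Uy.
have [rr r12 r123] := rotation_cross P1 P2.
by apply: (conformal_orthogonal (mu_neq0 Uy) rr r12 r123) => s; exact: B_omega.
Qed.

Let BBt y : U y -> Bm y *m (Bm y)^T = (mu y)%:M.
Proof.
move=> Uy; have m0 := mu_neq0 Uy.
have : ((mu y)^-1 *: (Bm y)^T) *m Bm y = 1%:M.
  by rewrite -scalemxAl BtB// scale_scalar_mx mulVf.
move/mulmx1C; rewrite -scalemxAr => /(congr1 (fun X => mu y *: X)).
by rewrite scalerA mulfV// scale1r scalemx1.
Qed.

Let B_cols y d b : U y -> \sum_(i < 4) B i d y * B i b y = mu y * (d == b)%:R.
Proof.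
move=> /BtB/matrixP/(_ d b); rewrite !mxE mulr_natr => <-.
by apply: eq_bigr => i _; rewrite !mxE.
Qed.

Let B_rows y i j : U y -> \sum_(d < 4) B i d y * B j d y = mu y * (i == j)%:R.
Proof.
move=> /BBt/matrixP/(_ i j); rewrite !mxE mulr_natr => <-.
by apply: eq_bigr => d _; rewrite !mxE.
Qed.

(* The components of d (ln mu) / 2 on H. *)
Let v y (a : 'I_4) : R := (2 * mu y)^-1 * (D a y mu : R).

Let v_smooth a y : U y -> smooth_at y (fun x => v x a).
Proof.
move=> Uy; have [_ smu] := Hmu Uy; apply: smooth_atM.
  apply: smooth_atV; first exact: smooth_atM (smooth_at_cst y 2) smu.
  by rewrite mulf_neq0 ?mu_neq0// pnatr_eq0.
exact: ((frame_smooth coframe _).2 y mu smu).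
Qed.

Let Dmu a y : U y -> D a y mu = 2 * mu y * v y a.
Proof. by move=> Uy; rewrite /v; field; exact: mu_neq0. Qed.

Let K y (d : 'I_4) (t : 'I_3) : R := (mu y)^-1 * \sum_(i < 4) B i d y * C i t y.

Let Psi_cols y t r : U y -> \sum_(s < 3) Psi y s t * Psi y s r = (t == r)%:R.
Proof.
move=> /HPsi[/mulmx1C/matrixP/(_ t r) + _]; rewrite !mxE => <-.
by apply: eq_bigr => s _; rewrite !mxE.
Qed.

(** The mixed part of d eta' = 2 omega' contains the unknown derivatives of Psi.
    They are removed by contracting with Psi: e_a of the squared length of a
    column of mu Psi, which is mu^2, involves mu only. *)
Let K_grad y d u : U y -> K y d u = conf_K (v y) d u.
Proof.
move=> Uy; have m0 := mu_neq0 Uy.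
have CK : Cm y = Bm y *m \matrix_(d, t) K y d t.
  have -> : \matrix_(d, t) K y d t = (mu y)^-1 *: ((Bm y)^T *m Cm y).
    apply/matrixP => d' t; rewrite !mxE; congr (_ * _).
    by apply: eq_bigr => i _; rewrite !mxE.
  rewrite -scalemxAr mulmxA BBt// mul_scalar_mx scalerA mulVf// scale1r//.
have JC s a : \sum_(i < 4) \sum_(j < 4) omega_coef R s i j * (B i a y * C j u y) =
    mu y * \sum_(d < 4) \sum_(r < 3) Psi y s r * omega_coef R r a d * K y d u.
  have -> : \sum_(i < 4) \sum_(j < 4) omega_coef R s i j * (B i a y * C j u y) =
      ((Bm y)^T *m omega_mx (fun t => (t == s)%:R) *m Cm y) a u.
    rewrite mxE exchange_big; apply: eq_bigr => j _ /=; rewrite mxE mulr_suml.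
    apply: eq_bigr => i _; rewrite omega_mx_delta !mxE; ring.
  rewrite CK mulmxA B_omega// -scalemxAl mxE; congr (_ * _); rewrite mxE.
  by apply: eq_bigr => d' _; rewrite !mxE mulr_suml.
have grad a : v y a = \sum_(d < 4) omega_coef R u a d * K y d u.
  have smu := (Hmu Uy).2.
  pose Q s := A (vidx s) (vidx u).
  have sQ s : smooth_at y (Q s) := sA _ _ Uy.
  have dQ s : D a y (Q s) = 2 * (mu y * \sum_(d < 4) \sum_(r < 3) Psi y s r
    * omega_coef R r a d * K y d u)
      - \sum_(r < 3) mu y * Psi y s r * L2_form (vidx r) (delta7 R (hidx a))
        (delta7 R (vidx u)).
    have := structure (vidx s) (hidx a) (vidx u) Uy.
    rewrite [e (vidx u) y _](@der_on _ _ _ (fun=> 0) Uy (smooth_at_cst y 0)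
      (fun x Ux => A_vh s a Ux)).
    rewrite (tangent_cst (te _ y)) subr0 H_form_v om_mx JC [X in _ - (X + _)]big1 =>
      [|k _]; last first.
      by rewrite (A_vh s k Uy) mul0r.
    by rewrite add0r => ->; congr (_ - _); apply: eq_bigr => r _; rewrite (A_vv s r Uy).
  have QQ : D a y (fun x => \sum_(s < 3) Q s x * Q s x) = D a y (fun x => mu x * mu x).
    apply: (der_on _ Uy); first exact: smooth_atM.
    move=> x Ux; have h1 : \sum_(s < 3) Psi x s u * Psi x s u = 1.
      by rewrite (Psi_cols u u Ux) eqxx.
    rewrite -[RHS]mulr1 -h1 mulr_sumr.
    by apply: eq_bigr => s _; rewrite /Q (A_vv s u Ux); ring.
  move: QQ; rewrite (tangent_bigsum (te _ y) _ (fun s => smooth_atM (sQ s) (sQ s))).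
  rewrite (tangent_leibniz (te _ y) smu smu) (Dmu _ Uy).
  under eq_bigr do rewrite (tangent_leibniz (te _ y) (sQ _) (sQ _)) dQ /Q (A_vv _ u Uy).
  move=> QQ.
  have S1 : \sum_(s < 3) Psi y s u * \sum_(d < 4) \sum_(r < 3) Psi y s r
    * omega_coef R r a d * K y d u =
      \sum_(d < 4) omega_coef R u a d * K y d u.
    under eq_bigr do rewrite mulr_sumr.
    rewrite exchange_big; apply: eq_bigr => d' _ /=.
    under eq_bigr do rewrite mulr_sumr.
    rewrite exchange_big /= (bigD1 u)//= [X in _ + X]big1 => [|r ru].
      rewrite addr0 (eq_bigr (fun s => (Psi y s u * Psi y s u)
        * (omega_coef R u a d' * K y d' u))); last by move=> s _; ring.
      by rewrite -mulr_suml (Psi_cols u u Uy) eqxx mul1r.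
    rewrite (eq_bigr (fun s => (Psi y s u * Psi y s r)
      * (omega_coef R r a d' * K y d' u))); last by move=> s _; ring.
    by rewrite -mulr_suml (Psi_cols u r Uy) eq_sym (negbTE ru) mul0r.
  have S2 : \sum_(s < 3) Psi y s u * \sum_(r < 3) mu y * Psi y s r *
      L2_form (vidx r) (delta7 R (hidx a)) (delta7 R (vidx u)) = 0.
    under eq_bigr do rewrite mulr_sumr.
    rewrite exchange_big /= (bigD1 u)//= [X in _ + X]big1 => [|r ru].
      rewrite addr0 big1// => s _; rewrite L2_form_vhv; ring.
    rewrite (eq_bigr (fun s => (Psi y s u * Psi y s r)
      * (mu y * L2_form (vidx r) (delta7 R (hidx a)) (delta7 R (vidx u)))));
      last by move=> s _; ring.
    by rewrite -mulr_suml (Psi_cols u r Uy) eq_sym (negbTE ru) mul0r.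
  have E : 4 * (mu y * mu y) * v y a =
    4 * (mu y * mu y) * \sum_(d < 4) omega_coef R u a d * K y d u.
    transitivity (4 * (mu y * mu y)
      * (\sum_(s < 3) Psi y s u * \sum_(d < 4) \sum_(r < 3) Psi y s r * omega_coef R
      r a d * K y d u)
      - 2 * mu y * \sum_(s < 3) Psi y s u * \sum_(r < 3) mu y * Psi y s r *
      L2_form (vidx r) (delta7 R (hidx a)) (delta7 R (vidx u)));
        last by rewrite S1 S2; ring.
    transitivity (2 * mu y * v y a * mu y + mu y * (2 * mu y * v y a)); first by ring.
    rewrite -QQ !mulr_sumr -sumrB; apply: eq_bigr => s _; ring.
  apply: (mulfI _ E); by rewrite !mulf_neq0// pnatr_eq0.
rewrite /conf_K; under eq_bigr do rewrite grad.
rewrite !sum4; elim/ord3P: u {CK JC grad}; elim/ord4P: d; rewrite /omega_coef /=; ring.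
Qed.

(** As for the Levi-Civita connection: B^-1 (e_a B) is determined by its
    symmetric part, from B^T B = mu, and by its torsion, from d theta' = 0. *)
Let B_derive a i b y : U y ->
  D a y (B i b) = \sum_(d < 4) B i d y * conf_M (v y) a d b.
Proof.
move=> Uy; have m0 := mu_neq0 Uy; have smu := (Hmu Uy).2.
pose M a d b := (mu y)^-1 * \sum_(j < 4) B j d y * D a y (B j b).
have sym a' d b' : M a' d b' + M a' b' d = 2 * v y a' * (d == b')%:R.
  have := @der_on (hidx a') y (fun x => \sum_(j < 4) B j d x * B j b' x)
    (fun x => mu x * (d == b')%:R) Uy (smooth_atM smu (smooth_at_cst y _))
    (fun x Ux => B_cols d b' Ux).
  rewrite (tangent_bigsum (te _ y) _ (fun j => smooth_atM (sA _ _ Uy) (sA _ _ Uy))).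
  rewrite (tangent_leibniz (te _ y) smu (smooth_at_cst y _)) (tangent_cst (te _ y)).
  rewrite mulr0 addr0 (Dmu _ Uy) => E.
  apply: (mulfI m0); transitivity (2 * mu y * v y a' * (d == b')%:R); last by ring.
  rewrite -E.
  rewrite /M mulrDr !mulrA mulfV// !mul1r -big_split; apply: eq_bigr => j _ /=.
  rewrite (tangent_leibniz (te _ y) (sA _ _ Uy) (sA _ _ Uy)); ring.
have tor a' b' d : M a' d b' - M b' d a' =
    - L2_hor_coef R d a' b' - 2 * \sum_(t < 3) conf_K (v y) d t * omega_coef R t a' b'.
  rewrite /M -mulrBr -sumrB.
  under eq_bigr do rewrite -mulrBr structure// H_form_h sub0r mulrN mulrDr.
  rewrite sumrN big_split /= mulrN mulrDr opprD; congr (- _ - _).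
    under eq_bigr do rewrite mulr_sumr.
    rewrite exchange_big /= mulr_sumr (bigD1 d)//= [X in _ + X]big1 => [|k kd].
      under eq_bigr do rewrite mulrA L2_form_hhh.
      by rewrite -mulr_suml B_cols// eqxx /=; field.
    under eq_bigr do rewrite mulrA L2_form_hhh.
    by rewrite -mulr_suml B_cols// eq_sym (negbTE kd) /=; ring.
  under eq_bigr do rewrite mulr_sumr.
  rewrite exchange_big /= !mulr_sumr; apply: eq_bigr => t _.
  under eq_bigr do rewrite mulrA L2_form_vhh.
  by rewrite -mulr_suml -K_grad// /K; ring.
have ME a' d b' : M a' d b' = conf_M (v y) a' d b'.
  pose N' a d b := M a d b - v y a * (d == b)%:R.
  have skew a1 c1 b1 : N' a1 c1 b1 = - N' a1 b1 c1.
    by have := sym a1 c1 b1; rewrite /N' (eq_sym b1); lra.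
  have torN a1 b1 c1 : N' a1 c1 b1 - N' b1 c1 a1 = conf_T (v y) c1 a1 b1.
    by have := tor a1 b1 c1; rewrite /N' /conf_T; lra.
  by have := koszul skew torN a' d b'; rewrite -conf_M_koszul /N'; lra.
under eq_bigr do rewrite -ME /M.
rewrite (eq_bigr (fun d => \sum_(j < 4) (mu y)^-1 * D a y (B j b)
  * (B i d y * B j d y))); last first.
  move=> d _; rewrite !mulr_sumr; apply: eq_bigr => j _; ring.
rewrite exchange_big /=; under eq_bigr do rewrite -mulr_sumr B_rows//.
rewrite (bigD1 i)//= big1 => [|j ji]; last by rewrite eq_sym (negbTE ji) !mulr0.
by rewrite eqxx /=; field.
Qed.

Let V y (a k : 'I_4) : R := D a y (fun x => v x k).

Let B_derive2 a b i c y : U y -> D a y (vf_app (D b) (B i c)) =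
  \sum_(d < 4) B i d y * (\sum_(f < 4) conf_M (v y) a d f * conf_M (v y) b f c
    + \sum_(k < 4) V y a k * (conf_M (delta4 R k) b d c - conf_M (fun=> 0) b d c)).
Proof.
move=> Uy.
pose L k d := conf_M (delta4 R k) b d c - conf_M (fun=> 0) b d c.
have sv k : smooth_at y (fun x => v x k) := v_smooth k Uy.
have sL k d := smooth_atM (sv k) (smooth_at_cst y (L k d)).
have sS d : smooth_at y (fun x => \sum_(k < 4) v x k * L k d).
  by apply: smooth_at_sum => k _; exact: sL.
have sM d := smooth_atD (smooth_at_cst y (conf_M (fun=> 0) b d c)) (sS d).
have sBM d := smooth_atM (sA (hidx i) (hidx d) Uy) (sM d).
have sT : smooth_at y (fun x => \sum_(d < 4) B i d x *
   (conf_M (fun=> 0) b d c + \sum_(k < 4) v x k * L k d)).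
  by apply: smooth_at_sum => d _; exact: sBM.
rewrite (der_on (hidx a) Uy sT); last first.
  move=> x Ux; rewrite /vf_app B_derive//; apply: eq_bigr => d _.
  by rewrite conf_M_affine.
rewrite (tangent_bigsum (te _ y) _ sBM).
transitivity (\sum_(d < 4) (\sum_(f < 4) B i f y * conf_M (v y) a f d * conf_M (v y)
  b d c
    + B i d y * \sum_(k < 4) V y a k * L k d)).
  apply: eq_bigr => d _.
  rewrite (tangent_leibniz (te _ y) (sA _ _ Uy) (sM d)) -conf_M_affine B_derive//
    mulr_suml.
  congr (_ + _ * _).
  rewrite (tangent_add (te _ y) (smooth_at_cst y _) (sS d)) (tangent_cst (te _ y))
    add0r.
  rewrite (tangent_bigsum (te _ y) _ (fun k => sL k d)); apply: eq_bigr => k _.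
  rewrite (tangent_leibniz (te _ y) (sv k) (smooth_at_cst y _)) (tangent_cst (te _ y)).
  by rewrite mulr0 addr0.
rewrite big_split exchange_big -big_split; apply: eq_bigr => d _ /=.
rewrite mulrDr; congr (_ + _); rewrite mulr_sumr; apply: eq_bigr => f _; ring.
Qed.

(** Both sides are the derivative of B along the vertical part of [e_a, e_b]. *)
Let B_integrable a b i c y : U y ->
  \sum_(d < 4) B i d y * conf_Z (v y) (V y) a b d c =
  - \sum_(t < 3) 2 * omega_coef R t a b * e (vidx t) y (B i c).
Proof.
move=> Uy.
have sB := sA (hidx i) (hidx c) Uy.
have := bracketE (D a) (D b) sB.
rewrite (tangent_expand coframe _
  (bracket_tangent y (frame_smooth coframe _) (frame_smooth coframe _))).
rewrite (@big_split_ord _ _ _ 4 3) /=.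
under eq_bigr do rewrite (frame_bracket coframe (L2_differential th_L2)) L2_form_hhh
  B_derive//.
under [X in _ + X = _]eq_bigr do
  rewrite (frame_bracket coframe (L2_differential th_L2)) L2_form_vhh.
rewrite !B_derive2//.
under eq_bigr do rewrite mulNr.
under [X in _ + X = _]eq_bigr do rewrite mulNr.
rewrite !sumrN.
have -> : \sum_(k < 4) L2_hor_coef R k a b * \sum_(d < 4) B i d y * conf_M (v y) k d c =
    \sum_(d < 4) B i d y * \sum_(k < 4) L2_hor_coef R k a b * conf_M (v y) k d c.
  under eq_bigr do rewrite mulr_sumr.
  rewrite exchange_big; apply: eq_bigr => d _ /=; rewrite mulr_sumr.
  by apply: eq_bigr => k _; ring.
move=> E; transitivity (
    \sum_(d < 4) B i d y * (\sum_(f < 4) conf_M (v y) a d f * conf_M (v y) b f c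
      + \sum_(k < 4) V y a k * (conf_M (delta4 R k) b d c - conf_M (fun=> 0) b d c))
    - \sum_(d < 4) B i d y * (\sum_(f < 4) conf_M (v y) b d f * conf_M (v y) a f c
      + \sum_(k < 4) V y b k * (conf_M (delta4 R k) a d c - conf_M (fun=> 0) a d c))
    + \sum_(d < 4) B i d y * \sum_(k < 4) L2_hor_coef R k a b * conf_M (v y) k d c).
  rewrite -sumrB -big_split; apply: eq_bigr => d _ /=.
  by rewrite /conf_Z sumrB; ring.
by rewrite -E; ring.
Qed.

(** In an anti-self-dual combination of planes the derivatives of B along the
    Reeb fields drop out, since d eta is self-dual on H; and B is invertible. *)
Let Z_asd a b a' b' c d y : U y ->
  (forall t, omega_coef R t a b = omega_coef R t a' b') ->
  conf_Z (v y) (V y) a b d c - conf_Z (v y) (V y) a' b' d c = 0.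
Proof.
move=> Uy ab.
pose Z d := conf_Z (v y) (V y) a b d c - conf_Z (v y) (V y) a' b' d c.
have BZ i : \sum_(d < 4) B i d y * Z d = 0.
  under eq_bigr do rewrite mulrBr.
  rewrite sumrB !B_integrable// opprK addrC; apply/eqP; rewrite subr_eq0; apply/eqP.
  by apply: eq_bigr => t _; rewrite ab.
apply: (mulfI (mu_neq0 Uy)); rewrite mulr0 -/(Z d).
transitivity (\sum_(i < 4) B i d y * \sum_(f < 4) B i f y * Z f); last first.
  by rewrite big1// => i _; rewrite BZ mulr0.
under [RHS]eq_bigr do rewrite mulr_sumr.
rewrite exchange_big /= (bigD1 d)//= [X in _ + X]big1 => [|f fd].
  rewrite addr0; under eq_bigr do rewrite mulrA.
  by rewrite -mulr_suml B_cols// eqxx mulr1.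
under eq_bigr do rewrite mulrA.
by rewrite -mulr_suml B_cols// eq_sym (negbTE fd) mulr0 mul0r.
Qed.

Lemma no_local_flattening p : ~ U p.
Proof.
move=> Up; have := conf_Z_weyl (v p) (V p) => /=.
have h1 t : omega_coef R t (i4 1) (i4 2) =
  omega_coef R t (i4 3) (i4 4) by elim/ord3P: t.
have h2 t : omega_coef R t (i4 1) (i4 3) =
  omega_coef R t (i4 4) (i4 2) by elim/ord3P: t.
rewrite !(Z_asd _ _ Up h1) !(Z_asd _ _ Up h2); lra.
Qed.

End NotFlat.

Theorem theorem3p3 (R : realType) (G : lieGroup R 7)
    (th : 'I_7 -> oneform G) (e : 'I_7 -> vfield G)
    (G_simply_connected : simply_connected R G)
    (th_left_invariant : left_invariant_coframe th e)
    (th_L2 : L2_equations th) :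
  let q := qc_of_coframe th e in
  is_qc q /\
  (exists (nabla : vfield G -> vfield G -> vfield G) (S : G -> R),
    [/\ is_the_biquard_connection q nabla,
        is_qc_scalar q nabla S,
        (forall U X, ver_field q U -> hor_field q X ->
           forall p, torsion nabla U X p = 0)
        /\ (forall p, S p = - 4^-1)
      & exists X Y Z W p,
          [/\ hor_field q X, hor_field q Y, hor_field q Z, hor_field q W
            & qc_W q nabla S X Y Z W p <> 0]]) /\
  ~ locally_qc_conformally_flat (qc_eta q).
Proof.
move=> q; have [coframe _] := th_left_invariant.
split; first exact: L2_is_qc.
split.
  exists (frame_conn th e (@L2_christoffel R)), (fun=> - 4^-1); split.
  - exact: nabla_is_the_biquard.
  - exact: L2_qc_scalar.
  - by split=> // U X hU hX p; exact: nabla_torsion_ver.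
  - exact: (L2_W_neq0 coframe th_L2 (lie_one G)).
move=> [N [th' [e' [_ [coframe' _] heis flat]]]].
have [U [F [F' [mu [Psi [[oU U1 _] hF hmu hPsi heta]]]]]] := flat (lie_one G).
have sF x (Ux : U x) : smooth_map_at F x by have [_ sFx _] := hF x Ux.
have hP x (Ux : U x) : Psi x *m (Psi x)^T = 1%:M /\ \det (Psi x) = 1.
  by have [P1 P2 _] := hPsi x Ux.
exact: (no_local_flattening coframe th_L2 coframe' heis oU sF hmu hP heta U1).
Qed.
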